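(* Let $d\ge 2$. Let $P$ and $Q$ be T-polytopes in $\mathbb{R}^{2d}$ that are combinatorially equivalent (their face lattices are isomorphic), and let $X$ and $Y$ be T-diagrams of (the vertex sets of) $P$ and $Q$ respectively. Then $X$ and $Y$ are combinatorially equivalent planar diagrams.
   Context: A convex polytope in $\mathbb{R}^{2d}$ is neighborly if every $d$ of its vertices form the vertex set of a face. Gale diagrams: let $X^*=\{x_1,\dots,x_N\}\subset\mathbb{R}^D$ affinely span $\mathbb{R}^D$. The space of affine dependencies $\{\lambda\in\mathbb{R}^N:\sum\lambda_i x_i=0,\sum\lambda_i=0\}$ has dimension $N-D-1$; writing a basis of it as rows of a matrix, its columns $\bar x_1,\dots,\bar x_N\in\mathbb{R}^{N-D-1}$ form the vector Gale diagram (nonzero vectors for vertex sets of polytopes). An affine Gale diagram $X$ is obtained by choosing an affine hyperplane $e$ not through $0$ and not parallel to any $\bar x_i$ and taking the intersection of the line $\mathbb{R}\bar x_i$ with $e$, colored black if it is a positive multiple of $\bar x_i$ and white otherwise. A T-diagram is an affine Gale diagram $X$ of the vertex set of a neighborly polytope in $\mathbb{R}^{2d}$ with $2d+4$ vertices such that $X$ has exactly $d+3$ black points and they are in convex position; such a polytope is called a T-polytope. Two planar diagrams are combinatorially equivalent if there is a bijection between them preserving colors, the ''lies between'' relation for collinear triples, and either preserving the orientation of every triple or reversing the orientation of every triple (equivalence up to mirror symmetry). *)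

(* Defs.v *)
From mathcomp Require Import all_boot all_order all_algebra all_fingroup.
From mathcomp Require Import boolp classical_sets functions reals.

Set Implicit Arguments.
Unset Strict Implicit.
Unset Printing Implicit Defensive.

Import Order.TTheory GRing.Theory Num.Theory.
Local Open Scope classical_set_scope.
Local Open Scope ring_scope.

(** * Convex polytopes *)

Definition conv_hull (R : realType) (D : nat) (A : set 'rV[R]_D) :
    set 'rV[R]_D :=
  [set y | exists n (a : 'I_n -> 'rV[R]_D) (w : 'I_n -> R),
     [/\ forall i, A (a i), forall i, 0 <= w i,
         \sum_i w i = 1 & y = \sum_i w i *: a i]].

Definition polytope (R : realType) (D : nat) (P : set 'rV[R]_D) : Prop :=
  exists s : seq 'rV[R]_D, P = conv_hull [set` s].

(* The linear form [c] may be zero, so that the empty set and [P] itself are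
   faces. *)
Definition face (R : realType) (D : nat) (P F : set 'rV[R]_D) : Prop :=
  exists (c : 'cV[R]_D) (b : R),
    (forall x, P x -> (x *m c) 0 0 <= b) /\
    F = [set x | P x /\ (x *m c) 0 0 = b].

Definition vertices (R : realType) (D : nat) (P : set 'rV[R]_D) :
    set 'rV[R]_D :=
  [set v | face P [set v]].

Definition neighborly (R : realType) (d : nat) (P : set 'rV[R]_(2 * d)) :
    Prop :=
  polytope P /\
  forall v : 'I_d -> 'rV[R]_(2 * d),
    injective v -> (forall i, vertices P (v i)) ->
    exists2 F, face P F & vertices F = range v.

(* Isomorphism of the face lattices, ordered by inclusion. *)
Definition polytope_equiv (R : realType) (D E : nat)
    (P : set 'rV[R]_D) (Q : set 'rV[R]_E) : Prop :=
  exists2 f : set 'rV[R]_D -> set 'rV[R]_E,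
    set_bij (face P) (face Q) f &
    forall F G, face P F -> face P G -> (F `<=` G <-> f F `<=` f G).

(** * Gale diagrams *)

Definition affinely_spanning (R : realType) (D N : nat)
    (x : 'I_N -> 'rV[R]_D) : Prop :=
  forall y, exists2 w : 'I_N -> R, \sum_i w i = 1 & y = \sum_i w i *: x i.

Definition affine_dependency (R : realType) (D N : nat)
    (x : 'I_N -> 'rV[R]_D) (l : 'rV[R]_N) : Prop :=
  \sum_i l 0 i *: x i = 0 /\ \sum_i l 0 i = 0.

(* The rows of [B] form a basis of the space of affine dependencies; this
   forces [k = N - D - 1]. *)
Definition vector_gale (R : realType) (D N k : nat)
    (x : 'I_N -> 'rV[R]_D) (B : 'M[R]_(k, N)) : Prop :=
  [/\ affinely_spanning x, row_free B &
      forall l, affine_dependency x l <-> (l <= B)%MS].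

(* The points are indexed by the points of the original configuration, hence
   counted with multiplicity; [black X i = false] means that point [i] is
   white. *)
Record diagram (R : realType) (k N : nat) := Diagram {
  point : 'I_N -> 'rV[R]_k;
  black : pred 'I_N
}.

(* The hyperplane [e] of R^(k+1) is given by an affine coordinate system
   [y |-> o + y *m U] with linearly independent directions [U], in which the
   points of the diagram are expressed.  All notions used below for diagrams
   are independent of that choice of coordinates on [e]. *)
Definition affine_gale (R : realType) (D N k : nat)
    (x : 'I_N -> 'rV[R]_D) (X : diagram R k N) : Prop :=
  exists B : 'M[R]_(k.+1, N), vector_gale x B /\
  exists (o : 'rV[R]_k.+1) (U : 'M[R]_(k, k.+1)),
    [/\ row_free U,
        forall y : 'rV[R]_k, o + y *m U != 0,
        forall i, ~~ ((col i B)^T <= U)%MS &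
        forall i, exists2 t : R,
          t *: (col i B)^T = o + point X i *m U & black X i = (0 < t)].

Definition black_convex_position (R : realType) (k N : nat)
    (X : diagram R k N) : Prop :=
  forall i, black X i ->
    ~ conv_hull [set p | exists j, [/\ black X j, j != i & p = point X j]]
        (point X i).

Definition T_diagram (R : realType) (d : nat) (P : set 'rV[R]_(2 * d))
    (X : diagram R 2 (2 * d + 4)) : Prop :=
  [/\ neighborly P,
      exists x : 'I_(2 * d + 4) -> 'rV[R]_(2 * d),
        [/\ injective x, range x = vertices P & affine_gale x X],
      #|[pred i | black X i]| = (d + 3)%N &
      black_convex_position X].

Definition T_polytope (R : realType) (d : nat) (P : set 'rV[R]_(2 * d)) :
    Prop :=
  exists X, T_diagram P X.

(** * Combinatorial equivalence of planar diagrams *)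

Definition orientation (R : realType) (p q r : 'rV[R]_2) : R :=
  Num.sg (\det (col_mx (q - p) (r - p) : 'M[R]_2)).

(* [q] lies between [p] and [r]. *)
Definition between (R : realType) (p q r : 'rV[R]_2) : Prop :=
  exists2 t : R, 0 < t < 1 & q = (1 - t) *: p + t *: r.

Definition diagram_equiv (R : realType) (N : nat) (X Y : diagram R 2 N) :
    Prop :=
  exists s : {perm 'I_N},
    [/\ forall i, black Y (s i) = black X i,
        forall i j k,
          between (point X i) (point X j) (point X k) <->
          between (point Y (s i)) (point Y (s j)) (point Y (s k)) &
        (forall i j k,
          orientation (point Y (s i)) (point Y (s j)) (point Y (s k)) =
          orientation (point X i) (point X j) (point X k)) \/
        (forall i j k,
          orientation (point Y (s i)) (point Y (s j)) (point Y (s k)) =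
          - orientation (point X i) (point X j) (point X k))].

(* Main.v *)
Require Import Defs.
From mathcomp Require Import all_boot all_order all_algebra all_fingroup.
From mathcomp Require Import boolp classical_sets reals.
From mathcomp Require Import ring lra zify.

(** Let [B] be the vector Gale diagram. Neighborliness says that every nonzero
    affine dependency has at least [d + 1] positive coordinates, so [B] is in
    general position and every plane through two of its vectors has exactly
    [d + 1] vectors on each side. The positive supports of dependencies of
    cardinality [d + 1] are exactly the [(d + 1)]-sets of vertices that are not
    faces, hence are combinatorial invariants; so are the corresponding sets
    for the diagram contracted at one or at two vectors, because [M] is such a
    set for the contraction at [i] iff both [M] and some [M - x + i] are such
    sets for [B]. Contracting at [i] and [k] gives the two sides of the plane
    through [i] and [k], so the face lattice determines all signs
    [det (B_i, B_j, B_k)] up to a global sign.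

    It remains to see that the colours agree. In a T-diagram every black point
    lies on a supporting line through another black point, so no black point is
    inside a triangle of points of either colour, while each black triangle
    contains a white point. If three points were black in [Y] and white in
    [X], the white point of [Y] in their triangle would contradict this in [X].
    So three points are black in both diagrams, and a fourth point cannot have
    different colours in [X] and [Y]: with respect to that triangle at most one
    of its three signs is negative if it is black, at most one is positive if
    it is white. *)

Set Implicit Arguments.
Unset Strict Implicit.
Unset Printing Implicit Defensive.

Import Order.TTheory GRing.Theory Num.Theory.
Local Open Scope classical_set_scope.
Local Open Scope ring_scope.

(** * Farkas lemma and convex hulls *)

(** Induction on the number of generators. If the first one is needed, some [z0] has nonpositive
    product with all the others but positive product with [b]; projecting along [a ord0] onto the
    hyperplane orthogonal to [z0] eliminates that generator. *)
Lemma farkas_ord (R : realFieldType) (D m : nat) (a : 'I_m -> 'rV[R]_D)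
    (b : 'rV[R]_D) :
  (forall z : 'cV[R]_D, (forall i, (a i *m z) 0 0 <= 0) ->
     (b *m z) 0 0 <= 0) ->
  exists2 w : 'I_m -> R, (forall i, 0 <= w i) & b = \sum_i w i *: a i.
Proof.
elim: m a b => [|m IH] a b hb.
  exists (fun=> 0) => //; rewrite big_ord0.
  (* Testing with [b^T] bounds the squared norm of [b] by 0. *)
  have := hb b^T (fun i => False_ind _ (notF (ltn_ord i))).
  rewrite mxE => h.
  have {}h : \sum_j b 0 j * b^T j 0 = 0.
    apply/eqP; rewrite eq_le h /=.
    by apply: sumr_ge0 => j _; rewrite mxE -expr2 sqr_ge0.
  apply/rowP => j; rewrite mxE.
  have h0 k : true -> 0 <= b 0 k * b^T k 0 by rewrite mxE -expr2 sqr_ge0.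
  have := psumr_eq0P h0 h (i := j) isT.
  by rewrite mxE -expr2 => /eqP; rewrite sqrf_eq0 => /eqP.
have [h|] := pselect (forall z : 'cV[R]_D,
    (forall i, (a (lift ord0 i) *m z) 0 0 <= 0) -> (b *m z) 0 0 <= 0).
  have [w w0 ->] := IH _ _ h.
  exists (fun i => if unlift ord0 i is Some j then w j else 0).
    by move=> i; case: unliftP.
  rewrite big_ord_recl unlift_none scale0r add0r.
  by apply: eq_bigr => i _; rewrite liftK.
move=> /existsNP[z0 /not_implyP[hz0 /negP]]; rewrite -ltNge => bz0.
have a0 : 0 < (a ord0 *m z0) 0 0.
  rewrite ltNge; apply/negP => h; move: bz0; rewrite ltNge => /negP; apply.
  by apply: hb => i; case: (unliftP ord0 i) => [j ->|->].
pose t := ((a ord0 *m z0) 0 0)^-1.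
have t0 : 0 < t by rewrite invr_gt0.
pose k (v : 'rV[R]_D) := (v *m z0) 0 0 * t.
have [|w w0 hw] := IH (fun i => a (lift ord0 i) - k (a (lift ord0 i)) *: a ord0)
                      (b - k b *: a ord0).
  (* [z'] is the adjoint projection of [z]; it is orthogonal to [a ord0], so [hb] applies to it. *)
  move=> z hz; pose z' := z - ((a ord0 *m z) 0 0 * t) *: z0.
  have E v : ((v - k v *: a ord0) *m z) 0 0 = (v *m z') 0 0.
    by rewrite mulmxBl mulmxBr -scalemxAl -scalemxAr /k !mxE; ring.
  rewrite E; apply: hb => i; case: (unliftP ord0 i) => [j ->|->].
    by rewrite -E.
  rewrite -E /k /t mulfV ?gt_eqF// scale1r subrr mul0mx mxE //.
(* The coefficient of [a ord0] lost in the projection is nonnegative, because [k b] is positive and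
   [k] is nonpositive on the other generators. *)
pose r := k b - \sum_i w i * k (a (lift ord0 i)).
exists (fun i => if unlift ord0 i is Some j then w j else r).
  move=> i; case: unliftP => // _.
  rewrite subr_ge0; apply: (@le_trans _ _ 0); last first.
    by rewrite mulr_ge0 // ltW.
  apply: sumr_le0 => j _; rewrite mulr_ge0_le0 // /k.
  by rewrite mulr_le0_ge0 // ltW.
rewrite big_ord_recl unlift_none.
under eq_bigr => i _ do rewrite liftK.
move/eqP: hw; rewrite subr_eq => /eqP ->.
under [X in X + _ = _]eq_bigr => i _ do rewrite scalerBr scalerA.
rewrite sumrB -scaler_suml /r scalerBl.
by rewrite -addrA [- _ + _]addrC [RHS]addrC.
Qed.

Lemma farkas (R : realFieldType) (D : nat) (I : finType) (a : I -> 'rV[R]_D)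
    (b : 'rV[R]_D) :
  (forall z : 'cV[R]_D, (forall i, (a i *m z) 0 0 <= 0) ->
     (b *m z) 0 0 <= 0) ->
  exists2 w : I -> R, (forall i, 0 <= w i) & b = \sum_i w i *: a i.
Proof.
move=> hb; have [|w w0 ->] := @farkas_ord R D #|I| (a \o enum_val) b.
  by move=> z hz; apply: hb => i; rewrite -(enum_rankK i); apply: hz.
exists (w \o enum_rank) => [i|]; first exact: w0.
rewrite (reindex (@enum_rank I)) /=; last first.
  by apply: onW_bij; apply: enum_rank_bij.
by apply: eq_bigr => i _ /=; rewrite enum_rankK.
Qed.

Lemma row_mx1_mul (R : realFieldType) (D : nat) (x : 'rV[R]_D)
    (z : 'cV[R]_(D + 1)) :
  (row_mx x 1%:M *m z) 0 0 = (x *m usubmx z) 0 0 + dsubmx z 0 0.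
Proof.
by rewrite -{1}(vsubmxK z) mul_row_col mul1mx !mxE.
Qed.

Section ConvexHull.
Variables (R : realType) (D : nat).
Implicit Types (A : set 'rV[R]_D) (s t : seq 'rV[R]_D) (x y v : 'rV[R]_D).

Lemma conv_hull_le A y (c : 'cV[R]_D) (b : R) :
  conv_hull A y -> (forall a, A a -> (a *m c) 0 0 <= b) -> (y *m c) 0 0 <= b.
Proof.
move=> [n [a [w [Aa w0 w1 ->]]]] hA.
rewrite mulmx_suml summxE -[b]mul1r -w1 mulr_suml.
by apply: ler_sum => i _; rewrite -scalemxAl mxE ler_wpM2l// hA.
Qed.

(** Farkas after homogenization: the extra coordinate 1 makes the weights sum to 1 and absorbs the
    constant [b]. *)
Lemma conv_hull_dual s y :
  (forall (c : 'cV[R]_D) (b : R),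
     (forall a, a \in s -> (a *m c) 0 0 <= b) -> (y *m c) 0 0 <= b) ->
  conv_hull [set` s] y.
Proof.
move=> h.
have [|w w0 hw] := @farkas_ord R (D + 1) (size s)
    (fun i => row_mx s`_i 1%:M) (row_mx y 1%:M).
  move=> z hz; rewrite row_mx1_mul -lerBrDr sub0r; apply: h => a /(nthP 0)[i si <-].
  by have := hz (Ordinal si); rewrite row_mx1_mul -lerBrDr sub0r.
exists (size s), (fun i => s`_i), w; split => //.
- by move=> i /=; rewrite mem_nth.
- have := congr1 (fun v : 'rV_(D + 1) => v 0 (rshift D 0)) hw.
  rewrite row_mxEr mxE eqxx summxE => /esym; apply: etrans.
  by apply: eq_bigr => i _; rewrite mxE row_mxEr mxE eqxx mulr1.
- apply/rowP => j.
  have := congr1 (fun v : 'rV_(D + 1) => v 0 (lshift 1 j)) hw.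
  rewrite row_mxEl !summxE => ->.
  by apply: eq_bigr => i _; rewrite mxE row_mxEl mxE.
Qed.

Lemma conv_hull_self A a : A a -> conv_hull A a.
Proof.
move=> Aa; exists 1%N, (fun=> a), (fun=> 1); split => //.
- by rewrite big_ord1.
- by rewrite big_ord1 scale1r.
Qed.

(** A convex combination that attains the bound puts weight only on points attaining it. *)
Lemma conv_hull_eq A y (c : 'cV[R]_D) (b : R) :
  conv_hull A y -> (forall a, A a -> (a *m c) 0 0 <= b) -> (y *m c) 0 0 = b ->
  exists2 a, A a & (a *m c) 0 0 = b.
Proof.
move=> [n [a [w [Aa w0 w1 ->]]]] hA.
rewrite mulmx_suml summxE => h.
have h0 i : true -> 0 <= w i * (b - (a i *m c) 0 0).
  by move=> _; rewrite mulr_ge0// subr_ge0 hA.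
have hs : \sum_i w i * (b - (a i *m c) 0 0) = 0.
  rewrite (eq_bigr (fun i => w i * b - (w i *: a i *m c) 0 0)).
    by rewrite sumrB -mulr_suml w1 h mul1r subrr.
  by move=> i _; rewrite mulrBr -scalemxAl; congr (_ - _); rewrite [RHS]mxE.
have [i wi] : exists i, w i != 0.
  apply: contrapT => /forallNP wz.
  have := oner_neq0 R; rewrite -w1 big1 ?eqxx// => i _.
  by apply/eqP; move/negP: (wz i); rewrite negbK.
exists (a i) => //.
have /eqP := psumr_eq0P h0 hs (i := i) isT.
by rewrite mulf_eq0 (negPf wi) subr_eq0 => /eqP.
Qed.

Lemma irredundant_generators s : exists t,
  [/\ {subset t <= s}, conv_hull [set` s] `<=` conv_hull [set` t] &
      forall v, v \in t -> ~ conv_hull [set` [seq u <- t | u != v]] v].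
Proof.
have [n] := ubnP (size s); elim: n s => // n IH s sn.
have [h|] := pselect (forall v, v \in s ->
    ~ conv_hull [set` [seq u <- s | u != v]] v); first by exists s; split.
move=> /existsNP[v /not_implyP[vs /contrapT hv]].
have [|t [ts st ht]] := IH [seq u <- s | u != v].
  suff h : (size [seq u <- s | u != v] < size s)%N by exact: leq_trans h sn.
  rewrite size_filter ltn_neqAle count_size andbT -all_count.
  by apply/negP => /allP/(_ _ vs); rewrite /= eqxx.
exists t; split => //.
  by move=> u /ts; rewrite mem_filter => /andP[].
move=> y hy; apply: st; apply: conv_hull_dual => c b hcb.
apply: (conv_hull_le hy) => a /= sa.
have [->|av] := eqVneq a v; last by apply: hcb; rewrite mem_filter av.
exact: (conv_hull_le hv).
Qed.

(** An irredundant generator [v] is strictly separated from the others by some [c], so [c] attains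
    its maximum over [P] at [v] alone and [v] is a vertex. *)
Lemma polytope_sub_conv_vertices (P : set 'rV[R]_D) :
  polytope P -> P `<=` conv_hull (vertices P).
Proof.
move=> [s ->]; have [t [ts st ht]] := irredundant_generators s.
move=> y /st [n [a [w [ta w0 w1 yE]]]]; exists n, a, w; split => // i.
have {ta y yE}/= := ta i; move: (a i) => v vt.
have [c [b [hb cv]]] : exists (c : 'cV[R]_D) (b : R),
    (forall u, u \in t -> u != v -> (u *m c) 0 0 <= b) /\ b < (v *m c) 0 0.
  apply: contrapT => h; apply: (ht v vt).
  apply: conv_hull_dual => c b hb; rewrite leNgt; apply/negP => hlt.
  apply: h; exists c, b; split => // u ut uv.
  by apply: hb; rewrite mem_filter uv.
have tle u : u \in t -> (u *m c) 0 0 <= (v *m c) 0 0.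
  have [->//|uv ut] := eqVneq u v.
  by rewrite (le_trans (hb _ ut uv))// ltW.
exists c, ((v *m c) 0 0); split.
  by move=> x /st hx; apply: conv_hull_le hx _.
apply/seteqP; split => [_ -> /=|x /= [/st[m [e [z [te z0 z1 ->]]]] hx]].
  by split => //; apply: conv_hull_self => /=; apply: ts.
suff h j : z j *: e j = z j *: v.
  by rewrite (eq_bigr _ (fun j _ => h j)) -scaler_suml z1 scale1r.
have h0 k : true -> 0 <= z k * ((v *m c) 0 0 - (e k *m c) 0 0).
  by move=> _; rewrite mulr_ge0// subr_ge0; apply/tle/te.
have hs : \sum_k z k * ((v *m c) 0 0 - (e k *m c) 0 0) = 0.
  rewrite (eq_bigr (fun k => z k * (v *m c) 0 0 - (z k *: e k *m c) 0 0)).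
    by rewrite sumrB -mulr_suml z1 -summxE -mulmx_suml hx mul1r subrr.
  by move=> k _; rewrite mulrBr -scalemxAl; congr (_ - _); rewrite [RHS]mxE.
have /eqP := psumr_eq0P h0 hs (i := j) isT.
rewrite mulf_eq0 => /orP[/eqP ->|]; first by rewrite !scale0r.
rewrite subr_eq0 => /eqP hj; have [->//|jv] := eqVneq (e j) v.
by have := hb _ (te j) jv; rewrite -hj leNgt cv.
Qed.

End ConvexHull.

(** * Faces and affine dependencies *)

Definition face_set (R : realType) (D N : nat) (P : set 'rV[R]_D)
    (x : 'I_N -> 'rV[R]_D) (M : {set 'I_N}) : Prop :=
  exists2 F, face P F & forall i, F (x i) <-> i \in M.

Section Faces.
Variables (R : realType) (D N : nat) (P : set 'rV[R]_D).
Variable x : 'I_N -> 'rV[R]_D.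
Hypotheses (polyP : polytope P) (xP : range x = vertices P).

Lemma vertices_sub (Q : set 'rV[R]_D) : vertices Q `<=` Q.
Proof.
by move=> v [c [b [_]]] /seteqP[/(_ v erefl)[]].
Qed.

Lemma vertex_point (i : 'I_N) : vertices P (x i).
Proof. by rewrite -xP; exists i => /=. Qed.

Lemma mem_point i : P (x i).
Proof. exact: (vertices_sub (vertex_point i)). Qed.

Lemma face_point1 i : face P [set x i].
Proof. exact: vertex_point. Qed.

Lemma polytope_le (c : 'cV[R]_D) (b : R) :
  (forall i, (x i *m c) 0 0 <= b) -> forall y, P y -> (y *m c) 0 0 <= b.
Proof.
move=> h y /(polytope_sub_conv_vertices polyP) hy.
by apply: (conv_hull_le hy); rewrite -xP => _ [i _ <-].
Qed.

Lemma face_has_point F y : face P F -> F y -> exists i, F (x i).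
Proof.
move=> [c [b [hb ->]]] /= [Py yb].
have hle a : vertices P a -> (a *m c) 0 0 <= b by move/vertices_sub/hb.
have [a] := conv_hull_eq (polytope_sub_conv_vertices polyP Py) hle yb.
by rewrite -xP => -[i _ <-] h; exists i; split => //; apply: mem_point.
Qed.

Lemma face_point_vertex F i : face P F -> F (x i) -> vertices F (x i).
Proof.
move=> [c [b [hb FE]]] Fx.
have [c' [b' [hb' E]]] := vertex_point i; exists c', b'; split.
  by move=> y; rewrite FE => -[/hb'].
apply/seteqP; split => [_ -> /=|y /= [Fy yb]].
  by split => //; move/seteqP: E => [/(_ _ erefl)[]].
have Py : P y by move: Fy; rewrite FE => -[].
by move/seteqP: E => [_ /(_ y)]; apply.
Qed.

(** Pair the dependency with the slacks [b - x j *m c] of a functional exposing the face. The sum is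
    0 and no term is positive, so all terms vanish and a negative coefficient forces zero slack. *)
Lemma face_set_dependency (l : 'rV[R]_N) (A : {set 'I_N}) :
  affine_dependency x l -> face_set P x A ->
  (forall i, 0 < l 0 i -> i \in A) -> forall i, l 0 i < 0 -> i \in A.
Proof.
move=> [l1 l2] [F [c [b [hb FE]]] FA] lA i li; apply/FA.
have h0 j : true -> 0 <= - (l 0 j * (b - (x j *m c) 0 0)).
  move=> _; have [jA|jA] := boolP (j \in A).
    by have /FA := jA; rewrite FE => -[_ ->]; rewrite subrr mulr0 oppr0.
  rewrite oppr_ge0 mulr_le0_ge0 ?subr_ge0//; last exact/hb/mem_point.
  by rewrite leNgt; apply/negP => /lA; rewrite (negPf jA).
have hs : \sum_j - (l 0 j * (b - (x j *m c) 0 0)) = 0.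
  rewrite sumrN (eq_bigr (fun j => l 0 j * b - (l 0 j *: x j *m c) 0 0)).
    by rewrite sumrB -mulr_suml l2 -summxE -mulmx_suml l1 mul0mx mxE mul0r subrr oppr0.
  by move=> j _; rewrite mulrBr -scalemxAl; congr (_ - _); rewrite [RHS]mxE.
have /eqP := psumr_eq0P h0 hs (i := i) isT.
rewrite oppr_eq0 mulf_eq0 lt_eqF//= subr_eq0 => /eqP bE.
by rewrite FE; split; [exact: mem_point|].
Qed.

(** Farkas alternative: for each [j] outside [M], either such a dependency exists or some supporting
    functional vanishes on [M] and is negative at [j]. *)
Lemma not_face_set_dependency (M : {set 'I_N}) : ~ face_set P x M ->
  exists l : 'rV[R]_N, [/\ affine_dependency x l,
    forall i, i \notin M -> l 0 i <= 0 & exists2 j, j \notin M & l 0 j < 0].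
Proof.
move=> nM; apply: contrapT => nl; apply: nM.
pose y i : 'rV[R]_(D + 1) := row_mx (x i) 1%:M.
have /choice[z hz] : forall j, exists z : 'cV[R]_(D + 1),
    [/\ forall i, i \in M -> (y i *m z) 0 0 = 0,
        forall i, (y i *m z) 0 0 <= 0 & j \notin M -> (y j *m z) 0 0 < 0].
  move=> j; have [jM|jM] := boolP (j \in M).
    by exists 0; split=> // i; rewrite ?mulmx0 ?mxE.
  apply: contrapT => nz; apply: nl.
  (* The second copy adds [- y i] for [i] in [M], which forces equality on [M]; 0 is a harmless
     filler elsewhere. *)
  pose a (i : 'I_N + 'I_N) : 'rV[R]_(D + 1) :=
    match i with inl i => y i | inr i => if i \in M then - y i else 0 end.
  have [|w w0 hw] := @farkas R (D + 1) ('I_N + 'I_N)%type a (- y j).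
    move=> u hu; rewrite mulNmx mxE oppr_le0 leNgt; apply/negP => hj.
    apply: nz; exists u; split=> [i iM|i|_ //]; last exact: (hu (inl i)).
    apply/eqP; rewrite eq_le (hu (inl i)) /=.
    by have := hu (inr i); rewrite /= iM mulNmx mxE oppr_le0.
  pose l := \row_i ((i \in M)%:R * w (inr i) - w (inl i) - (i == j)%:R).
  have hl : \sum_i l 0 i *: y i = 0.
    under eq_bigr => i _ do rewrite mxE !scalerBl.
    rewrite !sumrB [X in _ - X](bigD1 j)//= eqxx scale1r.
    rewrite [X in _ - (_ + X)]big1 => [|i /negPf ->]; last by rewrite scale0r.
    rewrite addr0 hw big_sumType /=.
    have -> : \sum_i w (inr i) *: (if i \in M then - y i else 0) =
              - \sum_i ((i \in M)%:R * w (inr i)) *: y i.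
      rewrite -sumrN; apply: eq_bigr => i _.
      by case: (i \in M); rewrite ?mul1r ?mul0r ?scalerN ?scaler0 ?scale0r ?oppr0.
    by rewrite addrA subrK subrr.
  exists l; split; [split| |].
  - apply/rowP => k; rewrite summxE [RHS]mxE.
    have := congr1 (fun v : 'rV_(D + 1) => v 0 (lshift 1 k)) hl.
    rewrite /= summxE [X in _ = X -> _]mxE => e; rewrite -[RHS]e.
    by apply: eq_bigr => i _; rewrite mxE [RHS]mxE row_mxEl.
  - have := congr1 (fun v : 'rV_(D + 1) => v 0 (rshift D 0)) hl.
    rewrite /= summxE [X in _ = X -> _]mxE => e; rewrite -[RHS]e.
    by apply: eq_bigr => i _; rewrite [RHS]mxE row_mxEr [X in _ * X]mxE eqxx mulr1.
  - move=> i /negPf iM; rewrite mxE iM mul0r sub0r -opprD oppr_le0.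
    by rewrite addr_ge0 ?w0 ?ler0n.
  - exists j => //; rewrite mxE (negPf jM) mul0r sub0r -opprD oppr_lt0 eqxx.
    by rewrite ltr_wpDl.
(* The sum vanishes on [M] and is negative at every point outside, so it exposes a face with exactly
   the points of [M]. *)
pose Z := \sum_j z j.
have hZ i : (y i *m Z) 0 0 = \sum_j (y i *m z j) 0 0.
  by rewrite /Z mulmx_sumr summxE.
have Zle i : (x i *m usubmx Z) 0 0 <= - dsubmx Z 0 0.
  rewrite -[leRHS]sub0r lerBrDr -row_mx1_mul hZ.
  by apply: sumr_le0 => j _; have [] := hz j.
exists [set p | P p /\ (p *m usubmx Z) 0 0 = - dsubmx Z 0 0].
  exists (usubmx Z), (- dsubmx Z 0 0); split => //; exact: polytope_le.
move=> i /=; have E : ((x i *m usubmx Z) 0 0 = - dsubmx Z 0 0) <->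
    (y i *m Z) 0 0 = 0.
  by rewrite row_mx1_mul; split => [->|/eqP]; rewrite ?addNr// addr_eq0 => /eqP.
rewrite E; split => [[_]|iM].
  rewrite hZ => h; apply: contrapT => /negP iM.
  have := hz i => -[_ _ /(_ iM)]; apply/negP; rewrite -leNgt.
  have h0 j : true -> 0 <= - (y i *m z j) 0 0.
    by move=> _; rewrite oppr_ge0; have [] := hz j.
  have hs : \sum_j - (y i *m z j) 0 0 = 0 by rewrite sumrN h oppr0.
  by have /eqP := psumr_eq0P h0 hs (i := i) isT; rewrite oppr_eq0 => /eqP ->.
split; first exact: mem_point.
by rewrite hZ big1 => // j _; have [h _ _] := hz j; apply: h.
Qed.

End Faces.

(** * Isomorphisms of face lattices as permutations of vertices *)

Section FaceLattice.
Variables (R : realType) (D E N : nat) (P : set 'rV[R]_D) (Q : set 'rV[R]_E).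
Variables (x : 'I_N -> 'rV[R]_D) (y : 'I_N -> 'rV[R]_E).
Hypotheses (xP : range x = vertices P) (xI : injective x).
Hypotheses (polyQ : polytope Q) (yQ : range y = vertices Q).

Lemma face_set0 (K : nat) (T : set 'rV[R]_K) : face T set0.
Proof.
exists 0, 1; split=> [z _|]; first by rewrite mulmx0 mxE ler01.
apply/seteqP; split => // z [_ /eqP].
by rewrite mulmx0 mxE eq_sym oner_eq0.
Qed.

(** Vertices are the atoms of the face lattice, so an isomorphism permutes them; incidence with a
    vertex is inclusion of a one-point face. *)
Lemma polytope_equiv_perm : polytope_equiv P Q ->
  exists s : {perm 'I_N},
    forall M : {set 'I_N}, face_set P x M <-> face_set Q y [set s i | i in M]%SET.
Proof.
move=> [f [fF fI fS] fle].
have f0 : f set0 = set0.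
  have [F PF F0] := fS _ (face_set0 Q); apply/seteqP; split => //.
  by rewrite -F0; apply/fle => //; apply: face_set0.
have fx i : exists j, f [set x i] = [set y j].
  have Fi := face_point1 xP i.
  have [z fz] : f [set x i] !=set0.
    apply/set0P/eqP => h.
    have : [set x i] = set0.
      by apply: fI; rewrite ?inE ?f0//; apply: face_set0.
    by move=> /seteqP[/(_ _ erefl)].
  have [j Fj] := face_has_point polyQ yQ (fF _ Fi) fz.
  (* The preimage [F] of the one-point face at [y j] lies in that at [x i], and is nonempty because
     the empty face maps to itself. *)
  have [F PF FE] := fS _ (face_point1 yQ j).
  exists j; rewrite -FE; congr f.
  have Fx : F `<=` [set x i] by apply/fle => //; rewrite FE => _ ->.
  apply/esym/seteqP; split => // _ ->.
  have [u Fu] : F !=set0.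
    apply/set0P/eqP => h; move: FE; rewrite h f0 => /seteqP[_ /(_ _ erefl)].
    by [].
  by rewrite -(Fx _ Fu).
have [s0 hs0] := choice fx.
have s0I : injective s0.
  move=> i j ij; apply: xI.
  have : [set x i] = [set x j].
    by apply: fI; rewrite ?inE ?hs0 ?ij//; apply: face_point1.
  by move=> /seteqP[/(_ _ erefl)].
have fmem F i : face P F -> F (x i) <-> f F (y (s0 i)).
  move=> PF; have := fle _ _ (face_point1 xP i) PF.
  rewrite hs0 => -[h1 h2]; split => h.
    by apply: h1 => // _ ->.
  by apply: h2 => // _ ->.
exists (perm s0I) => M; split => [[F PF FM]|[G QG GM]].
  exists (f F); first exact: fF.
  move=> j; rewrite -(permKV (perm s0I) j); set k := (X in perm s0I X).
  by rewrite mem_imset; [rewrite permE -FM -fmem|apply: perm_inj].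
have [F PF FE] := fS _ QG; exists F => // i.
by rewrite fmem// FE GM -(permE s0I) mem_imset; [|apply: perm_inj].
Qed.

End FaceLattice.

(** * Rigidity *)

Definition pos_set (R : realType) (N : nat) (B : 'M[R]_(3, N))
    (u : 'rV[R]_3) : {set 'I_N} :=
  [set i | 0 < (u *m B) 0 i]%SET.

Lemma card_disjoint3 (T : finType) (A B C : {set T}) :
  (forall x, ((x \in A) + (x \in B) + (x \in C) <= 1)%N) ->
  (#|A| + #|B| + #|C| <= #|T|)%N.
Proof.
move=> h; rewrite -!sum1_card.
rewrite [X in (X + _ + _)%N]big_mkcond [X in (_ + X + _)%N]big_mkcond.
rewrite [X in (_ + X)%N]big_mkcond -!big_split /= leq_sum// => x _.
by have := h x; case: (x \in A); case: (x \in B); case: (x \in C).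
Qed.

Definition zero_set (R : realType) (N : nat) (B : 'M[R]_(3, N))
    (u : 'rV[R]_3) : {set 'I_N} :=
  [set i | (u *m B) 0 i == 0]%SET.

(* When [#|M| = d + 1] and [B] is a Gale diagram of a neighborly polytope, this
   means that [M] is not a face, see [missing_not_face_set]. *)
Definition missing (R : realType) (N : nat) (B : 'M[R]_(3, N))
    (M : {set 'I_N}) : Prop :=
  exists u, pos_set B u = M.

(** The triple product, spelled out in coordinates so that [ring] applies. *)
Definition det3 (R : realType) (a b c : 'I_3 -> R) : R :=
  let o0 : 'I_3 := @Ordinal 3 0 isT in
  let o1 : 'I_3 := @Ordinal 3 1 isT in
  let o2 : 'I_3 := @Ordinal 3 2 isT in
  (a o1 * b o2 - a o2 * b o1) * c o0 + (a o2 * b o0 - a o0 * b o2) * c o1 +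
  (a o0 * b o1 - a o1 * b o0) * c o2.

(** The chirotope of the columns, before taking signs. *)
Definition chi (R : realType) (N : nat) (B : 'M[R]_(3, N)) (i j k : 'I_N) : R :=
  det3 (B^~ i) (B^~ j) (B^~ k).

Definition cross3 (R : realType) (a b : 'I_3 -> R) : 'rV[R]_3 :=
  let o0 : 'I_3 := @Ordinal 3 0 isT in
  let o1 : 'I_3 := @Ordinal 3 1 isT in
  let o2 : 'I_3 := @Ordinal 3 2 isT in
  \row_k (match val k with
    | 0 => a o1 * b o2 - a o2 * b o1
    | 1 => a o2 * b o0 - a o0 * b o2
    | _ => a o0 * b o1 - a o1 * b o0
  end).

Lemma sum_ord3 (V : nmodType) (F : 'I_3 -> V) :
  \sum_i F i = F (@Ordinal 3 0 isT) + F (@Ordinal 3 1 isT) + F (@Ordinal 3 2 isT).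
Proof.
rewrite !big_ord_recl big_ord0 addr0 addrA.
by congr (F _ + F _ + F _); apply: val_inj.
Qed.

Lemma chi_cross (R : realType) (N : nat) (B : 'M[R]_(3, N)) i j k :
  chi B i j k = (cross3 (B^~ i) (B^~ j) *m B) 0 k.
Proof. by rewrite mxE sum_ord3 !mxE. Qed.

(** * Balanced vector configurations *)

Section Balanced.
Variables (R : realType) (d : nat) (B : 'M[R]_(3, 2 * d + 4)).
Local Notation N := (2 * d + 4)%N.
Local Notation g u i := (((u : 'rV[R]_3) *m B) 0 i).
Hypothesis bal : forall u, u != 0 -> (d < #|pos_set B u|)%N.

Lemma mul_comb (a b : R) (u v : 'rV[R]_3) i :
  g (a *: u + b *: v) i = a * g u i + b * g v i.
Proof. by rewrite mulmxDl -!scalemxAl !mxE. Qed.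

Lemma mul_scale (a : R) (u : 'rV[R]_3) i : g (a *: u) i = a * g u i.
Proof. by rewrite -scalemxAl [LHS]mxE. Qed.

Lemma mul_opp (u : 'rV[R]_3) i : g (- u) i = - g u i.
Proof. by rewrite mulNmx [LHS]mxE. Qed.

(** Applied to [u] and [- u], [bal] uses up at least [2 d + 2] of the [2 d + 4] points. *)
Lemma zero_set_le2 u : u != 0 -> (#|zero_set B u| <= 2)%N.
Proof.
move=> u0; have b1 := bal u0.
have b2 : (d < #|pos_set B (- u)|)%N by apply: bal; rewrite oppr_eq0.
have e1 : (#|pos_set B u| + #|pos_set B (- u)| + #|zero_set B u| <= N)%N.
  rewrite -[leqRHS](card_ord N); apply: card_disjoint3 => i.
  by rewrite !inE mul_opp oppr_gt0; case: ltgtP.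
lia.
Qed.

Lemma zeros_eq u i j k : u != 0 -> i != j -> i != k -> j != k ->
  g u i = 0 -> g u j = 0 -> g u k != 0.
Proof.
move=> u0 ij ik jk ui uj; apply/negP => /eqP uk.
have := zero_set_le2 u0; apply/negP; rewrite -ltnNge.
have /subset_leq_card : [set i; j; k]%SET \subset zero_set B u.
  by apply/fintype.subsetP => x; rewrite !inE => /orP[/orP[]|] /eqP ->; apply/eqP.
apply: leq_trans.
by rewrite -finset.setUA !cardsU1 !inE cards1 (negPf ij) (negPf ik) (negPf jk).
Qed.

(** The two zeros leave [2 d + 2] points, and each open side needs at least [d + 1] of them. *)
Lemma card_pos_set u i j : u != 0 -> i != j -> g u i = 0 -> g u j = 0 ->
  #|pos_set B u| = d.+1.
Proof.
move=> u0 ij ui uj; have b1 := bal u0.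
have b2 : (d < #|pos_set B (- u)|)%N by apply: bal; rewrite oppr_eq0.
have e1 : (#|pos_set B u| + #|pos_set B (- u)| + #|[set i; j]%SET| <= N)%N.
  rewrite -[leqRHS](card_ord N); apply: card_disjoint3 => k.
  rewrite !inE mul_opp oppr_gt0.
  have [->|ki] := eqVneq k i; first by rewrite ui ltxx.
  have [->|kj] := eqVneq k j; first by rewrite uj ltxx.
  by case: ltgtP.
by move: e1; rewrite cards2 ij; lia.
Qed.

Lemma exists_vanishing (i j : 'I_N) :
  exists2 u, u != 0 & g u i = 0 /\ g u j = 0.
Proof.
pose A : 'M[R]_(3, 1 + 1) := row_mx (col i B) (col j B).
have kA : kermx A != 0.
  rewrite -mxrank_eq0 mxrank_ker -lt0n subn_gt0.
  exact: leq_ltn_trans (rank_leq_col A) _.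
exists (nz_row (kermx A)); first by rewrite nz_row_eq0.
have : nz_row (kermx A) *m A = 0 by apply/sub_kermxP; apply: nz_row_sub.
rewrite mul_mx_row -row_mx0 => /eq_row_mx[h1 h2].
by split; [move: h1|move: h2] => /matrixP/(_ 0 0); rewrite !mxE => e;
  rewrite -[RHS]e; apply: eq_bigr => k _; rewrite mxE.
Qed.

Lemma exists_other (i j : 'I_N) : exists k : 'I_N, k != i /\ k != j.
Proof.
apply: contrapT => h; have : (#|[set: 'I_N]%SET| <= #|[set i; j]%SET|)%N.
  apply/subset_leq_card/fintype.subsetP => k _; rewrite !inE.
  apply: contrapT => /negP; rewrite negb_or => /andP[ki kj].
  by apply: h; exists k.
rewrite cardsT card_ord cards2; lia.
Qed.

(** The combination of [u] and [v] that cancels at [k] has three zeros, hence is zero. *)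
Lemma proportional u v i j k l : v != 0 -> i != j -> g u i = 0 -> g u j = 0 ->
  g v i = 0 -> g v j = 0 -> g v k * g u l = g u k * g v l.
Proof.
move=> v0 ij ui uj vi vj.
have [->|ki] := eqVneq k i; first by rewrite ui vi !mul0r.
have [->|kj] := eqVneq k j; first by rewrite uj vj !mul0r.
pose w := g v k *: u + (- g u k) *: v.
have w0 : w = 0.
  apply/eqP; apply: contrapT => /negP w0.
  have wi : g w i = 0 by rewrite /w mul_comb ui vi !mulr0 addr0.
  have wj : g w j = 0 by rewrite /w mul_comb uj vj !mulr0 addr0.
  have : g w k != 0.
    by apply: (zeros_eq w0 ij _ _ wi wj); rewrite [_ == k]eq_sym.
  by rewrite /w mul_comb mulNr mulrC subrr eqxx.
have := congr1 (fun w => g w l) w0.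
rewrite /w mul_comb mul0mx [RHS]mxE => /eqP.
by rewrite mulNr subr_eq0 => /eqP.
Qed.

Lemma chi_swap (i j k : 'I_N) : chi B j i k = - chi B i j k.
Proof. by rewrite /chi /det3 /=; ring. Qed.

Lemma chi_rot (i j k : 'I_N) : chi B j k i = chi B i j k.
Proof. by rewrite /chi /det3 /=; ring. Qed.

Lemma chi_ii (i j : 'I_N) : chi B i j i = 0.
Proof. by rewrite /chi /det3 /=; ring. Qed.

Lemma chi_jj (i j : 'I_N) : chi B i j j = 0.
Proof. by rewrite /chi /det3 /=; ring. Qed.

(** If the cross product vanished, columns [i] and [j] would be parallel. A form vanishing at [i]
    but not at [j] then shows that column [i] is zero, so a form through [j] and [k] would have
    three zeros. *)
Lemma chi_neq0 (i j k : 'I_N) : i != j -> i != k -> j != k -> chi B i j k != 0.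
Proof.
move=> ij ik jk; rewrite chi_cross; set c := cross3 _ _.
have [c0|c0] := eqVneq c 0; last first.
  by apply: zeros_eq ij ik jk _ _; rewrite -?chi_cross ?chi_ii ?chi_jj.
exfalso; have Vi0 (u : 'rV[R]_3) : g u i = 0.
  have [u' u'0 [ui uk]] := exists_vanishing i k.
  have uj : g u' j != 0 by apply: zeros_eq u'0 ik ij _ ui uk; rewrite eq_sym.
  apply/eqP; rewrite -(mulrI_eq0 _ (lregP uj)); apply/eqP.
  transitivity (g u' j * g u i - g u' i * g u j); first by rewrite ui mul0r subr0.
  have e0 := congr1 (fun w : 'rV[R]_3 => w 0 (@Ordinal 3 0 isT)) c0.
  have e1 := congr1 (fun w : 'rV[R]_3 => w 0 (@Ordinal 3 1 isT)) c0.
  have e2 := congr1 (fun w : 'rV[R]_3 => w 0 (@Ordinal 3 2 isT)) c0.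
  rewrite !mxE /= in e0 e1 e2; rewrite !mxE !sum_ord3.
  set o0 := (@Ordinal 3 0 isT) in e0 e1 e2 *.
  set o1 := (@Ordinal 3 1 isT) in e0 e1 e2 *.
  set o2 := (@Ordinal 3 2 isT) in e0 e1 e2 *.
  (* Binet-Cauchy identity: the difference is the cross product of the columns paired with that of
     [u] and [u']. *)
  transitivity (
      (B o1 i * B o2 j - B o2 i * B o1 j) * (u' 0 o2 * u 0 o1 - u' 0 o1 * u 0 o2)
    + (B o2 i * B o0 j - B o0 i * B o2 j) * (u' 0 o0 * u 0 o2 - u' 0 o2 * u 0 o0)
    + (B o0 i * B o1 j - B o1 i * B o0 j) * (u' 0 o1 * u 0 o0 - u' 0 o0 * u 0 o1)).
    ring.
  by rewrite e0 e1 e2 !mul0r !addr0.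
have [u u0 [uj uk]] := exists_vanishing j k.
have : g u i != 0 by apply: (zeros_eq u0 jk _ _ uj uk); rewrite [_ == i]eq_sym.
by rewrite Vi0 eqxx.
Qed.
(* Rotate the plane [u = 0] about the line through [i] so that [k] becomes
   positive, until it hits the next point [x]; balancedness forces [x] to come
   from the positive side. *)
Lemma rotate u i k : u != 0 -> i != k -> g u i = 0 -> g u k = 0 ->
  exists2 x, x \in pos_set B u &
    exists u', [/\ u' != 0, g u' i = 0, g u' x = 0 &
      pos_set B u' = k |: (pos_set B u :\ x)]%SET.
Proof.
move=> u0 ik ui uk; have un y : y != i -> y != k -> g u y != 0.
  by move=> yi yk; apply: (zeros_eq u0 ik _ _ ui uk); rewrite eq_sym.
have [y0 [y0i y0k]] := exists_other i k.
have [e [e_i e_k]] : exists e, g e i = 0 /\ g e k = 1.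
  have [e e0 [ei ey]] := exists_vanishing i y0.
  have ek : g e k != 0 by apply: (zeros_eq e0 _ ik y0k ei ey); rewrite eq_sym.
  exists ((g e k)^-1 *: e); rewrite !mul_scale ei mulr0.
  by rewrite mulVf.
(* At [y] other than [i] and [k], [e - c *: u] takes the value [g u y * (f y - c)]; the minimal
   ratio is thus where a sign first changes as [c] grows from minus infinity. *)
pose f y := g e y / g u y.
case: (arg_minP f (i0 := y0) (P := fun y => (y != i) && (y != k))).
  by rewrite y0i y0k.
move=> x /andP[xi xk] xmin.
pose u' := 1 *: e + (- f x) *: u.
have u'E y : y != i -> y != k -> g u' y = g u y * (f y - f x).
  by move=> yi yk; rewrite /u' mul_comb /f; field; rewrite !un.
have u'i : g u' i = 0 by rewrite /u' mul_comb ui e_i !mulr0 addr0.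
have u'k : g u' k = 1 by rewrite /u' mul_comb uk e_k mulr0 addr0 mulr1.
have u'x : g u' x = 0 by rewrite u'E// subrr mulr0.
have u'0 : u' != 0.
  by apply/eqP => h; move: u'k; rewrite h mul0mx mxE => /eqP; rewrite eq_sym oner_eq0.
have fpos y : y != i -> y != k -> y != x -> 0 < f y - f x.
  move=> yi yk yx; rewrite lt_neqAle subr_ge0 xmin ?yi// andbT eq_sym.
  have : g u' y != 0 by apply: (zeros_eq u'0 _ _ _ u'i u'x); rewrite eq_sym.
  by rewrite u'E// mulf_eq0 negb_or => /andP[].
have pE : pos_set B u' = (k |: (pos_set B u :\ x))%SET.
  apply/setP => y; rewrite !inE.
  have [->|yk] := eqVneq y k; first by rewrite u'k ltr01.
  have [->|yx] := eqVneq y x; first by rewrite u'x ltxx.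
  have [->|yi] := eqVneq y i; first by rewrite u'i ui.
  by rewrite u'E// pmulr_lgt0// fpos.
have ix : i != x by rewrite eq_sym.
exists x; last by exists u'.
have := card_pos_set u'0 ix u'i u'x; rewrite pE cardsU1 !inE uk ltxx andbF.
have := card_pos_set u0 ik ui uk; rewrite (cardsD1 x) inE.
case: (0 < g u x) => //; rewrite add0n add1n => -> /eqP.
by rewrite eqn_leq ltnn.
Qed.

(** Formulated through [missing] alone, so that it transfers between configurations; it detects
    positive supports of forms vanishing at [i], see [missing_delP]. *)
Definition missing_del (i : 'I_N) (M : {set 'I_N}) :=
  missing B M /\ exists2 x, x \in M & missing B (i |: (M :\ x))%SET.

Definition missing_del2 (i k : 'I_N) (M : {set 'I_N}) :=
  missing_del i M /\ exists2 x, x \in M & missing_del i (k |: (M :\ x))%SET.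

Lemma combine u1 u2 (i x : 'I_N) (M : {set 'I_N}) : (0 < d)%N ->
  #|M| = d.+1 -> i \notin M -> x \in M ->
  pos_set B u1 = M -> pos_set B u2 = (i |: (M :\ x))%SET ->
  exists2 c : R * R, g (c.1 *: u1 + c.2 *: u2) i = 0 &
    pos_set B (c.1 *: u1 + c.2 *: u2) = M.
Proof.
move=> d0 cM iM xM p1 p2.
have h1 y : (0 < g u1 y) = (y \in M) by rewrite -p1 inE.
have h2 y : (0 < g u2 y) = (y \in i |: (M :\ x))%SET by rewrite -p2 inE.
have a0 : 0 < g u2 i by rewrite h2 !inE eqxx.
have b0 : 0 <= - g u1 i by rewrite oppr_ge0 leNgt h1.
exists (g u2 i, - g u1 i) => /=; set u := _ *: _ + _.
  by rewrite /u mul_comb mulNr mulrC subrr.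
have uM : pos_set B u \subset M.
  apply/fintype.subsetP => y; rewrite inE; apply: contraLR => yM.
  have [->|yi] := eqVneq y i; first by rewrite /u mul_comb mulNr mulrC subrr ltxx.
  rewrite -leNgt /u mul_comb.
  have l1 : g u1 y <= 0 by rewrite leNgt h1.
  have l2 : g u2 y <= 0 by rewrite leNgt h2 !inE (negPf yi) (negPf yM) andbF.
  by rewrite -[leRHS]addr0 lerD// mulr_ge0_le0// ltW.
apply/eqP; rewrite eqEcard uM cM; apply: bal.
have [z zM zx] : exists2 z, z \in M & z != x.
  apply: contrapT => h; have : (#|M| <= #|[set x]%SET|)%N.
    apply/subset_leq_card/fintype.subsetP => z zM; rewrite inE.
    by apply: contrapT => /negP zx; apply: h; exists z.
  by rewrite cM cards1; lia.
apply/eqP => h; have : 0 < g u z; last by rewrite h mul0mx mxE ltxx.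
rewrite /u mul_comb ltr_wpDr//.
  by rewrite mulr_ge0// ltW// h2 !inE zx zM orbT.
by rewrite mulr_gt0// h1.
Qed.

Lemma missing_delP (i : 'I_N) (M : {set 'I_N}) : (0 < d)%N ->
  #|M| = d.+1 -> i \notin M -> missing_del i M ->
  exists2 u, g u i = 0 & pos_set B u = M.
Proof.
move=> d0 cM iM [[u1 p1] [x xM [u2 p2]]].
have [c ci cp] := combine d0 cM iM xM p1 p2.
by exists (c.1 *: u1 + c.2 *: u2).
Qed.

Lemma missing_del2P (i k : 'I_N) (M : {set 'I_N}) : (0 < d)%N ->
  #|M| = d.+1 -> i != k -> i \notin M -> k \notin M -> missing_del2 i k M ->
  exists u, [/\ g u i = 0, g u k = 0 & pos_set B u = M].
Proof.
move=> d0 cM ik iM kM [h1 [x xM h2]].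
have [u1 u1i p1] := missing_delP d0 cM iM h1.
have [||u2 u2i p2] := missing_delP d0 _ _ h2.
- by rewrite cardsU1 !inE (negPf kM) andbF /=; move: cM; rewrite (cardsD1 x) xM.
- by rewrite !inE (negPf ik) (negPf iM) andbF.
have [c ck cp] := combine d0 cM kM xM p1 p2.
exists (c.1 *: u1 + c.2 *: u2); split => //.
by rewrite mul_comb u1i u2i !mulr0 addr0.
Qed.

Lemma pos_set_missing_del u i k : u != 0 -> i != k -> g u i = 0 -> g u k = 0 ->
  missing_del i (pos_set B u).
Proof.
move=> u0 ik ui uk; split; first by exists u.
have ki : k != i by rewrite eq_sym.
have [x xu [u' [_ _ _ pE]]] := rotate u0 ki uk ui.
by exists x => //; exists u'.
Qed.

(** Rotating about [i] until [k] enters produces a new zero [x], so the rotated form has two zeros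
    again and [pos_set_missing_del] applies to it too. *)
Lemma pos_set_missing_del2 u i k : u != 0 -> i != k -> g u i = 0 -> g u k = 0 ->
  missing_del2 i k (pos_set B u).
Proof.
move=> u0 ik ui uk; split; first exact: pos_set_missing_del uk.
have [x xu [u' [u'0 u'i u'x pE]]] := rotate u0 ik ui uk.
exists x => //; rewrite -pE; apply: pos_set_missing_del u'x => //.
by apply/eqP => ix; move: xu; rewrite -ix inE ui ltxx.
Qed.
End Balanced.

(** * Signs determined by the missing sets *)

Section Rigidity.
Variables (R : realType) (d : nat) (B C : 'M[R]_(3, 2 * d + 4)).
Local Notation N := (2 * d + 4)%N.
Hypothesis d0 : (0 < d)%N.
Hypothesis balB : forall u, u != 0 -> (d < #|pos_set B u|)%N.
Hypothesis balC : forall u, u != 0 -> (d < #|pos_set C u|)%N.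
Hypothesis missBC : forall M : {set 'I_N}, #|M| = d.+1 ->
  missing B M -> missing C M.

Lemma missing_del_sub (i : 'I_N) (M : {set 'I_N}) : #|M| = d.+1 -> i \notin M ->
  missing_del B i M -> missing_del C i M.
Proof.
move=> cM iM [h1 [x xM h2]]; split; first exact: missBC.
exists x => //; apply: missBC => //.
by rewrite cardsU1 !inE (negPf iM) andbF /=; move: cM; rewrite (cardsD1 x) xM.
Qed.

Lemma missing_del2_sub (i k : 'I_N) (M : {set 'I_N}) : #|M| = d.+1 ->
  i != k -> i \notin M -> k \notin M ->
  missing_del2 B i k M -> missing_del2 C i k M.
Proof.
move=> cM ik iM kM [h1 [x xM h2]]; split; first exact: missing_del_sub.
exists x => //; apply: missing_del_sub => //.
  by rewrite cardsU1 !inE (negPf kM) andbF /=; move: cM; rewrite (cardsD1 x) xM.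
by rewrite !inE (negPf ik) (negPf iM) andbF.
Qed.

(** The positive side of the plane through [i] and [k] transfers to [C] as the positive support of a
    form [w] vanishing at [i] and [k]. It has no other zeros, so all its signs are those of
    [chi B i k]. *)
Lemma chi_sg_pair (i k : 'I_N) : i != k -> exists e : R,
  forall x, Num.sg (chi C i k x) = e * Num.sg (chi B i k x).
Proof.
move=> ik; set u := cross3 (B^~ i) (B^~ k).
have uE x : chi B i k x = (u *m B) 0 x by apply: chi_cross.
have ui : (u *m B) 0 i = 0 by rewrite -uE chi_ii.
have uk : (u *m B) 0 k = 0 by rewrite -uE chi_jj.
have [y [yi yk]] := exists_other i k.
have u0 : u != 0.
  apply/eqP => h; have := chi_neq0 balB ik _ _ (k := y).
  by rewrite uE h mul0mx mxE eqxx ![_ == y]eq_sym => /(_ yi yk).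
set v := cross3 (C^~ i) (C^~ k).
have vE x : chi C i k x = (v *m C) 0 x by apply: chi_cross.
have vi : (v *m C) 0 i = 0 by rewrite -vE chi_ii.
have vk : (v *m C) 0 k = 0 by rewrite -vE chi_jj.
have cM := card_pos_set balB u0 ik ui uk.
have [||||w [wi wk wp]] := missing_del2P balC d0 cM ik _ _
  (missing_del2_sub cM ik _ _ (pos_set_missing_del2 balB u0 ik ui uk)).
- by rewrite inE ui ltxx.
- by rewrite inE uk ltxx.
- by rewrite inE ui ltxx.
- by rewrite inE uk ltxx.
have w0 : w != 0.
  apply/eqP => h; move: cM; rewrite -wp h.
  suff -> : pos_set C 0 = finset.set0 by rewrite cards0.
  by apply/setP => x; rewrite !inE mul0mx mxE ltxx.
have sgw x : Num.sg ((w *m C) 0 x) = Num.sg (chi B i k x).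
  have [->|xi] := eqVneq x i; first by rewrite wi chi_ii.
  have [->|xk] := eqVneq x k; first by rewrite wk chi_jj.
  have wx : (w *m C) 0 x != 0.
    by apply: (zeros_eq balC w0 ik _ _ wi wk); rewrite eq_sym.
  have bx : chi B i k x != 0 by apply: chi_neq0 => //; rewrite eq_sym.
  have : (x \in pos_set C w) = (x \in pos_set B u) by rewrite wp.
  rewrite !inE -uE; case: (sgrP ((w *m C) 0 x)) wx => // _ _.
    by move=> /esym h; rewrite gtr0_sg.
  by move=> /esym /negbT; rewrite -leNgt le_eqVlt (negPf bx) => /ltr0_sg ->.
have wy : (w *m C) 0 y != 0.
  by apply: (zeros_eq balC w0 ik _ _ wi wk); rewrite eq_sym.
(* [v] and [w] share two zeros, so they are proportional; the factor is read off at [y]. *)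
exists (Num.sg (((w *m C) 0 y)^-1 * (v *m C) 0 y)) => x.
rewrite -sgw -sgrM vE; congr Num.sg; apply: (mulfI wy).
rewrite (proportional balC y x w0 ik vi vk wi wk).
by rewrite !mulrA mulfV// mul1r mulrC.
Qed.

(** The factors of the pairs agree: antisymmetry of [chi] gives [e i j = e j i], and cyclic
    invariance then gives [e i j = e i k]. *)
Lemma chi_sg : exists2 e : R, e != 0 &
  forall i j k, Num.sg (chi C i j k) = e * Num.sg (chi B i j k).
Proof.
have /choice[e0 he0] : forall p : 'I_N * 'I_N, exists e : R, p.1 != p.2 ->
    forall x, Num.sg (chi C p.1 p.2 x) = e * Num.sg (chi B p.1 p.2 x).
  move=> [i k] /=; have [->|ik] := eqVneq i k; first by exists 0.
  by have [e he] := chi_sg_pair ik; exists e.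
pose e i k := e0 (i, k).
have he i k x : i != k -> Num.sg (chi C i k x) = e i k * Num.sg (chi B i k x).
  by move=> ik; apply: (he0 (i, k)).
have sB i j k : i != j -> i != k -> j != k -> Num.sg (chi B i j k) != 0.
  by move=> ij ik jk; rewrite sgr_eq0 chi_neq0.
have eC i j : i != j -> e i j = e j i.
  move=> ij; have [k [ki kj]] := exists_other i j.
  have ji : j != i by rewrite eq_sym.
  have h1 := he _ _ k ij; have h2 := he _ _ k ji.
  have hB : Num.sg (chi B i j k) != 0 by apply: sB => //; rewrite eq_sym.
  apply: (mulIf hB); rewrite -h1.
  by move: h2; rewrite !(chi_swap _ i j) !sgrN mulrN => /oppr_inj.
have eR i j k : i != j -> i != k -> e i j = e i k.
  move=> ij ik; have [->//|jk] := eqVneq j k.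
  have h1 := he _ _ k ij; have ki : k != i by rewrite eq_sym.
  have h2 := he _ _ j ki; rewrite -!(chi_rot _ k i j) in h2.
  by apply: (mulIf (sB _ _ _ ij ik jk)); rewrite -h1 h2 eC.
have i0 : 'I_N by apply: (@Ordinal _ 0); lia.
have [j0 [j0i _]] := exists_other i0 i0.
have eE i j : i != j -> e i j = e i0 j0.
  move=> ij; have [iE|ii0] := eqVneq i i0.
    by rewrite iE in ij *; apply: eR; rewrite // eq_sym.
  by rewrite (eR _ _ i0)// eC// (eR _ _ j0)// eq_sym.
exists (e i0 j0).
  have [k [ki kj]] := exists_other i0 j0.
  have := he i0 j0 k; rewrite eq_sym => /(_ j0i) h; apply/eqP => eE0.
  have := chi_neq0 balC (i := i0) (j := j0) (k := k).
  rewrite -sgr_eq0 h eE0 mul0r eqxx ![_ == k]eq_sym [_ == j0]eq_sym.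
  by move=> /(_ j0i ki kj).
move=> i j k; have [->|ij] := eqVneq i j; last by rewrite he// eE.
by rewrite !(chi_rot _ k j j) !chi_jj !sgr0 mulr0.
Qed.
End Rigidity.

(** * Planar diagrams *)

Definition area (R : realType) (p q r : 'rV[R]_2) : R :=
  (q 0 0 - p 0 0) * (r 0 1 - p 0 1) - (q 0 1 - p 0 1) * (r 0 0 - p 0 0).

Lemma orientationE (R : realType) (p q r : 'rV[R]_2) :
  orientation p q r = Num.sg (area p q r).
Proof.
set a := q - p; set b := r - p.
have e0 j : (col_mx a b : 'M_2) 0 j = a 0 j.
  by rewrite -(col_mxEu a b); congr (col_mx _ _ _ _); apply: val_inj.
have e1 j : (col_mx a b : 'M_2) 1 j = b 0 j.
  by rewrite -(col_mxEd a b); congr (col_mx _ _ _ _); apply: val_inj.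
rewrite /orientation -/a -/b.
move: (col_mx a b : 'M_2) e0 e1 => M e0 e1; rewrite (expand_det_row _ 0).
rewrite big_ord_recl big_ord1 /cofactor !det_mx11 !mxE /=.
have -> : lift 0 0 = 1 :> 'I_2 by apply: val_inj.
have -> : lift 1 0 = 0 :> 'I_2 by apply: val_inj.
rewrite !e0 !e1 /a /b !mxE /area; congr Num.sg; rewrite /bump /=; ring.
Qed.

Section Area.
Variables (R : realType) (N : nat) (p : 'I_N -> 'rV[R]_2).
Local Notation E i j k := (area (p i) (p j) (p k)).

Lemma area_rot i j k : E j k i = E i j k.
Proof. by rewrite /area; ring. Qed.

Lemma area_swap i j k : E i k j = - E i j k.
Proof. by rewrite /area; ring. Qed.

Lemma area_iij i k : E i i k = 0.
Proof. by rewrite /area; ring. Qed.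

Lemma area_iji i j : E i j i = 0.
Proof. by rewrite /area; ring. Qed.

Lemma area_ijj i j : E i j j = 0.
Proof. by rewrite /area; ring. Qed.

(** Three-term Grassmann-Plücker relation for the vectors from [z] to [x], [y], [w], [q]. *)
Lemma area_plucker z x y w q :
  E z x y * E z q w + E z y w * E z q x + E z w x * E z q y = 0.
Proof. by rewrite /area; ring. Qed.

Lemma area_split z x y w : E z x y + E z y w + E z w x = E x y w.
Proof. by rewrite /area; ring. Qed.

End Area.

Lemma sum_nat_of_bool (T : finType) (P : pred T) :
  (\sum_x (P x : nat))%N = #|[set x | P x]%SET|.
Proof.
rewrite -sum1_card [RHS]big_mkcond; apply: eq_bigr => x _.
by rewrite inE; case: (P x).
Qed.

(* Positive iff [x] is on the same side of the plane [jk] as [i]. *)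
Definition side (R : realType) (N : nat) (B : 'M[R]_(3, N)) (i j k x : 'I_N) : R :=
  chi B j k x * chi B i j k.

(** * Black points and triangles in one diagram *)

Section Chart.
Variables (R : realType) (d : nat) (B : 'M[R]_(3, 2 * d + 4)).
Local Notation N := (2 * d + 4)%N.
Hypothesis bal : forall u, u != 0 -> (d < #|pos_set B u|)%N.
Variables (X : diagram R 2 (2 * d + 4)) (t : 'I_(2 * d + 4) -> R) (kappa : R).
Hypothesis t0 : forall i, t i != 0.
Hypothesis tb : forall i, black X i = (0 < t i).
Hypothesis tchi : forall i j k, t i * t j * t k * chi B i j k =
  kappa * area (Defs.point X i) (Defs.point X j) (Defs.point X k).
Hypothesis cb : #|black X| = (d + 3)%N.
Hypothesis convX : black_convex_position X.
Local Notation E i j k := (area (Defs.point X i) (Defs.point X j) (Defs.point X k)).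

Lemma kappa_neq0 : kappa != 0.
Proof.
have i0 : 'I_N by apply: (@Ordinal _ 0); rewrite addn_gt0 orbT.
have [j [j0 _]] := exists_other i0 i0; have [k [k0 kj]] := exists_other i0 j.
apply/eqP => h; have := tchi i0 j k; rewrite h mul0r; apply/eqP.
by rewrite !mulf_neq0 ?t0// (chi_neq0 bal)// eq_sym.
Qed.

Lemma area_neq0 i j k : i != j -> i != k -> j != k -> E i j k != 0.
Proof.
move=> ij ik jk; apply/eqP => h; have := tchi i j k; rewrite h mulr0; apply/eqP.
by rewrite !mulf_neq0 ?t0// (chi_neq0 bal).
Qed.

Lemma card_chi_lt0 i j c : i != j -> c != 0 ->
  #|[set x | (chi B i j x * c < 0)%R]%SET| = d.+1.
Proof.
move=> ij c0; set u := cross3 (B^~ i) (B^~ j).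
have uE x : ((- c *: u) *m B) 0 x = - (chi B i j x * c).
  by rewrite mul_scale -chi_cross mulNr mulrC.
have [y [yi yj]] := exists_other i j.
rewrite -(@card_pos_set R d B bal (- c *: u) i j)//.
- by apply: eq_card => x; rewrite !inE uE oppr_gt0.
- apply/eqP => h; have := uE y; rewrite h mul0mx mxE => /esym /eqP.
  apply/negP; rewrite oppr_eq0 mulf_neq0// (chi_neq0 bal)// eq_sym//.
- by rewrite uE chi_ii mul0r oppr0.
- by rewrite uE chi_jj mul0r oppr0.
Qed.

(** Up to a factor independent of [x] and the square of [t x], this product is [chi B i j x]: black
    points left of the line and white points right of it form one side of the plane. *)
Lemma card_balanced i j : i != j ->
  #|[set x | (0 < t x * E i j x)%R]%SET| = d.+1.
Proof.
move=> ij; have k0 := kappa_neq0.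
rewrite -(@card_chi_lt0 i j (- (t i * t j / kappa)))//; last first.
  by rewrite oppr_eq0 !mulf_neq0 ?invr_eq0.
apply: eq_card => x; rewrite !inE mulrN oppr_lt0.
have -> : t x * E i j x = t x ^+ 2 * (chi B i j x * (t i * t j / kappa)).
  apply: (mulfI k0); rewrite mulrCA -tchi; field.
  exact: k0.
by rewrite pmulr_rgt0// exprn_even_gt0 /=.
Qed.

(** Divided by their sum, the three areas are the barycentric coordinates of [z]. *)
Lemma not_black_triangle z x y w :
  black X z -> black X x -> black X y -> black X w ->
  0 < E z x y -> 0 < E z y w -> 0 < E z w x -> False.
Proof.
move=> bz bx by_ bw h1 h2 h3; apply: (convX bz).
pose s := E x y w; have s0 : 0 < s.
  rewrite /s -(area_split (Defs.point X) z x y w).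
  by apply: addr_gt0 => //; apply: addr_gt0.
exists 3, (fun i : 'I_3 => Defs.point X (match val i with 0 => x | 1 => y | _ => w end)),
  (fun i : 'I_3 => match val i with 0 => E z y w | 1 => E z w x | _ => E z x y end / s).
split.
- move=> [[|[|[|//]]] ?] /=; [exists x|exists y|exists w]; split => //; apply/eqP => h.
  + by move: h1; rewrite h area_iij ltxx.
  + by move: h2; rewrite h area_iij ltxx.
  + by move: h3; rewrite h area_iij ltxx.
- by move=> [[|[|[|//]]] ?] /=; rewrite ltW// divr_gt0.
- rewrite sum_ord3 /= -!mulrDl; apply/eqP.
  rewrite (_ : _ + _ + _ = s) ?divff ?lt0r_neq0//.
  by rewrite /s -(area_split (Defs.point X) z x y w); ring.
- rewrite sum_ord3 /=; apply/rowP => k; rewrite !mxE.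
  have sn : s != 0 by rewrite gt_eqF.
  have es a b : s * (a / s * b) = a * b by rewrite mulrA mulrCA mulfV// mulr1.
  apply: (mulfI sn); rewrite !mulrDr !es.
  have [->|->] : k = 0 \/ k = 1.
    by case: k => [[|[|//]] ?]; [left|right]; apply: val_inj.
  + by rewrite /s /area; ring.
  + by rewrite /s /area; ring.
Qed.

(* The neighbour [q] maximizes the number of black points left of [zq];
   balancedness then puts the white points on the same side. *)
Lemma black_edge z : black X z -> exists q, forall x, x != z -> x != q ->
  0 < E z q x.
Proof.
move=> bz; pose L q := [set x | black X x && (0 < E z q x)%R]%SET.
have [y0 /andP[by0 y0z]] : exists y, black X y && (y != z).
  apply: contrapT => h; have : (#|black X| <= #|[set z]%SET|)%N.
    apply/subset_leq_card/fintype.subsetP => y yb; rewrite inE.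
    by apply: contrapT => /negP yz; apply: h; exists y; rewrite yz andbT.
  by rewrite cb cards1; lia.
case: (@arg_maxnP _ y0 (fun y => black X y && (y != z)) (fun q => #|L q|)).
  by rewrite by0.
move=> q /andP[bq qz] qmax.
have bpos x : black X x -> x != z -> x != q -> 0 < E z q x.
  move=> bx xz xq; rewrite ltNge; apply/negP => xle.
  have xlt : E z q x < 0.
    by rewrite lt_neqAle xle andbT area_neq0// eq_sym.
  (* Yet [L q] is properly contained in [L x]: a black [y] in [L q] but not in [L x] would put [z]
     inside the triangle [q y x], and [q] itself is only in [L x]. *)
  have : (#|L x| <= #|L q|)%N by apply: qmax; rewrite bx.
  apply/negP; rewrite -ltnNge; apply: proper_card; apply/properP; split.
    apply/fintype.subsetP => y; rewrite !inE => /andP[b_y qy]; rewrite b_y /=.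
    rewrite ltNge; apply/negP => yle.
    have yz : y != z by apply/eqP => h; move: qy; rewrite h area_iji ltxx.
    have yx : y != x by apply/eqP => h; move: qy; rewrite h ltNge ltW.
    have ylt : E z x y < 0.
      by rewrite lt_neqAle yle andbT area_neq0// eq_sym.
    apply: (@not_black_triangle z q y x) => //.
      by rewrite area_swap oppr_gt0.
    by rewrite area_swap oppr_gt0.
  exists q; first by rewrite !inE bq area_swap oppr_gt0.
  by rewrite !inE area_ijj ltxx andbF.
exists q => x xz xq.
have [bx|wx] := boolP (black X x); first exact: bpos.
have zq : z != q by rewrite eq_sym.
rewrite ltNge; apply/negP => xle.
have xlt : E z q x < 0 by rewrite lt_neqAle xle andbT area_neq0// eq_sym.
have tx : t x < 0 by rewrite lt_neqAle t0 leNgt -tb wx.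
(* With the [d + 1] black points other than [z] and [q], a white [x] right of [zq] makes [d + 2]
   points on a side that has only [d + 1]. *)
have : (#|x |: ([set y in black X] :\ z :\ q)| <= 
        #|[set y | (0 < t y * E z q y)%R]|)%N%SET.
  apply/subset_leq_card/fintype.subsetP => y; rewrite !inE => /orP[/eqP ->|].
    by rewrite nmulr_lgt0.
  by move=> /and3P[yq yz yb]; rewrite mulr_gt0// -?tb// bpos.
rewrite card_balanced// cardsU1 !inE xq xz /= -topredE /= (negPf wx).
have := cardsD1 q ([set y in black X] :\ z)%SET.
have := cardsD1 z [set y in black X]%SET.
rewrite !inE qz -!topredE /= bz bq cardsE cb.
lia.
Qed.

(** With [q] from [black_edge], all terms of [area_plucker] are nonnegative and one is positive,
    although they sum to 0. *)
Lemma not_triangle z x y w : black X z ->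
  0 < E z x y -> 0 < E z y w -> 0 < E z w x -> False.
Proof.
move=> bz h1 h2 h3; have [q hq] := black_edge bz.
have ge0 v : 0 <= E z q v.
  have [->|vz] := eqVneq v z; first by rewrite area_iji.
  have [->|vq] := eqVneq v q; first by rewrite area_ijj.
  exact/ltW/hq.
have wz : w != z by apply/eqP => h; move: h3; rewrite h area_iij ltxx.
have xz : x != z by apply/eqP => h; move: h1; rewrite h area_iij ltxx.
have := area_plucker (Defs.point X) z x y w q; apply/eqP; rewrite gt_eqF//.
have [wq|wq] := eqVneq w q.
  have xq : x != q by apply/eqP => h; move: h3; rewrite wq h area_ijj ltxx.
  by rewrite addrAC ltr_wpDl ?mulr_gt0 ?hq// addr_ge0// mulr_ge0// ltW.
by rewrite -addrA ltr_wpDr ?mulr_gt0 ?hq// addr_ge0// mulr_ge0// ltW.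
Qed.

(** Using [tchi] twice, [kappa ^+ 2 * E j k x * E i j k] equals [t i * (t j * t k) ^+ 2 * (t x *
    side B i j k x)], so the colour of [i] decides how signs compare. *)
Lemma side_area i j k x : black X i ->
  (t x * side B i j k x < 0) = (E j k x * E i j k < 0).
Proof.
move=> bi; have ti : 0 < t i by rewrite -tb.
have k2 : 0 < kappa ^+ 2 by rewrite exprn_even_gt0// kappa_neq0.
rewrite -(pmulr_rlt0 (E j k x * E i j k) k2).
rewrite -(@pmulr_rlt0 _ (t i * (t j * t k) ^+ 2) (t x * side B i j k x));
  last first.
  by rewrite mulr_gt0// exprn_even_gt0//= mulf_neq0.
congr (_ < 0); transitivity ((kappa * E j k x) * (kappa * E i j k)); last by ring.
by rewrite -!tchi /side; ring.
Qed.

Lemma side_area_white i j k x : ~~ black X i -> 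
  (side B i j k x < 0) = (0 < t x * (E j k x * E i j k)).
Proof.
move=> bi; have ti : t i < 0 by rewrite lt_neqAle t0 leNgt -tb bi.
have k2 : 0 < kappa ^+ 2 by rewrite exprn_even_gt0// kappa_neq0.
rewrite -(pmulr_rgt0 (t x * (E j k x * E i j k)) k2).
rewrite -(@nmulr_rgt0 _ (t i * (t j * t k * t x) ^+ 2) (side B i j k x));
  last first.
  by rewrite nmulr_rlt0// exprn_even_gt0//= !mulf_neq0.
congr (0 < _); transitivity (t x * ((kappa * E j k x) * (kappa * E i j k))); last by ring.
by rewrite -!tchi /side; ring.
Qed.

(** In the plane, [x] would lie beyond both [jk] and [ki], which puts the black point [k] inside the
    triangle [i j x]. *)
Lemma not_two_outside i j k x : black X i -> black X j -> black X k ->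
  t x * side B i j k x < 0 -> t x * side B j k i x < 0 -> False.
Proof.
move=> bi bj bk; rewrite !side_area// (area_rot _ i j k).
case: (ltrgt0P (E i j k)) => [s0|s0|->]; last by rewrite mulr0 ltxx.
- rewrite !(pmulr_llt0 _ s0) => h1 h2.
  apply: (not_triangle (x := i) (y := j) (w := x) bk).
  + by rewrite -area_rot.
  + by rewrite area_swap oppr_gt0 area_rot.
  + by rewrite area_swap oppr_gt0.
- rewrite !(nmulr_llt0 _ s0) => h1 h2.
  apply: (not_triangle (x := j) (y := i) (w := x) bk) => //.
  + by rewrite area_swap oppr_gt0 -area_rot.
  + by rewrite area_rot.
Qed.

(* Each of the three planes has [d + 1] points on its negative side. A black
   point is on at most one negative side, so counting forces a white point to be
   on all three. *)
Lemma exists_interior i j k : i != j -> i != k -> j != k ->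
  black X i -> black X j -> black X k ->
  exists x, [/\ side B i j k x < 0, side B j k i x < 0 & side B k i j x < 0].
Proof.
move=> ij ik jk bi bj bk; apply: contrapT => /forallNP h.
have c0 : chi B i j k != 0 by apply: (chi_neq0 bal).
have e1 : chi B j k i = chi B i j k by apply: chi_rot.
have e2 : chi B k i j = chi B i j k by rewrite -chi_rot.
have s1 a b c : (side B a b c a < 0) = false.
  by rewrite /side chi_rot -expr2 ltNge sqr_ge0.
have s2 a b c : (side B a b c b < 0) = false by rewrite /side chi_ii mul0r ltxx.
have s3 a b c : (side B a b c c < 0) = false by rewrite /side chi_jj mul0r ltxx.
pose f x := ((side B i j k x < 0)%R + (side B j k i x < 0)%R +
            (side B k i j x < 0)%R + (x \in [set i; j; k]%SET))%N.
have le x : (f x <= 1 + ~~ black X x)%N.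
  rewrite /f !inE.
  have [->|xi] := eqVneq x i; first by rewrite s1 s2 s3.
  have [->|xj] := eqVneq x j; first by rewrite s1 s2 s3.
  have [->|xk] := eqVneq x k; first by rewrite s1 s2 s3.
  have [bx|wx] := boolP (black X x); last first.
    have := h x; case: (side B i j k x < 0); case: (side B j k i x < 0);
      by case: (side B k i j x < 0) => // H; exfalso; apply: H; split.
  have tx : 0 < t x by rewrite -tb.
  have n1 := not_two_outside (x := x) bi bj bk.
  have n2 := not_two_outside (x := x) bj bk bi.
  have n3 := not_two_outside (x := x) bk bi bj.
  rewrite !(pmulr_rlt0 _ tx) in n1 n2 n3.
  move: n1 n2 n3; case: (side B i j k x < 0); case: (side B j k i x < 0);
    by case: (side B k i j x < 0) => // n1 n2 n3; exfalso; auto.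
(* The totals are [3 (d + 1) + 3] on the left and [(2 d + 4) + (d + 1)] on the right, one too
   few. *)
have := leq_sum (index_enum 'I_N) (fun x (_ : true) => le x).
rewrite /f !big_split /= !sum_nat_of_bool sum1_card.
have -> : #|[set x | (side B i j k x < 0)%R]%SET| = d.+1.
  by rewrite -(card_chi_lt0 jk c0); apply: eq_card => x; rewrite !inE.
have -> : #|[set x | (side B j k i x < 0)%R]%SET| = d.+1.
  rewrite -(@card_chi_lt0 k i _ _ c0) 1?eq_sym//.
  by apply: eq_card => x; rewrite !inE /side e1.
have -> : #|[set x | (side B k i j x < 0)%R]%SET| = d.+1.
  by rewrite -(card_chi_lt0 ij c0); apply: eq_card => x; rewrite !inE /side e2.
have -> : #|[set x | x \in [set i; j; k]]%SET| = 3%N.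
  rewrite -finset.setUA (_ : [set x | _]%SET = [set i; j; k]%SET).
    by rewrite -finset.setUA !cardsU1 !inE cards1 (negPf ij) (negPf ik) (negPf jk).
  by apply/setP => x; rewrite !inE orbA.
have -> : #|[set x | ~~ black X x]%SET| = d.+1.
  transitivity #|predC (black X)|; first by apply: eq_card => x; rewrite !inE.
  have := cardC (black X); rewrite cb card_ord => hc.
  by apply: (@addnI (d + 3)%N); apply: etrans hc _; lia.
rewrite cardT size_enum_ord.
lia.
Qed.

(** A black [x] would be inside the triangle [i j k], against [not_triangle]. For a white [x], three
    negative products would sum to the square of the area. *)
Lemma not_interior_white i j k x :
  ~~ black X i -> ~~ black X j -> ~~ black X k ->
  side B i j k x < 0 -> side B j k i x < 0 -> side B k i j x < 0 -> False.
Proof.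
move=> wi wj wk; rewrite !side_area_white// (area_rot _ i j k).
rewrite -(area_rot _ k i j); have := t0 x; rewrite neq_lt => /orP[tx|tx].
  rewrite !(nmulr_rgt0 _ tx) => h1 h2 h3.
  have : E i j k * E i j k < 0; last by rewrite -expr2 ltNge sqr_ge0.
  have -> : E i j k * E i j k = E j k x * E i j k + E k i x * E i j k + E i j x * E i j k.
    by rewrite -!mulrDl; congr (_ * _); rewrite /area; ring.
  by rewrite -[ltRHS]addr0 ltrD// -[ltRHS]addr0 ltrD.
rewrite !(pmulr_rgt0 _ tx) => h1 h2 h3.
have bx : black X x by rewrite tb.
move: h1 h2 h3; case: (ltrgt0P (E i j k)) => [s0|s0|->]; last by rewrite mulr0 ltxx.
- rewrite !(pmulr_lgt0 _ s0) => h1 h2 h3.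
  by apply: (not_triangle (x := i) (y := j) (w := k) bx); rewrite -area_rot.
- rewrite !(nmulr_lgt0 _ s0) => h1 h2 h3.
  apply: (not_triangle (x := k) (y := j) (w := i) bx);
    by rewrite area_swap oppr_gt0 -area_rot.
Qed.

End Chart.

Definition gale_chart (R : realType) (d : nat) (B : 'M[R]_(3, 2 * d + 4))
    (X : diagram R 2 (2 * d + 4)) (t : 'I_(2 * d + 4) -> R) (kappa : R) : Prop :=
  [/\ forall u, u != 0 -> (d < #|pos_set B u|)%N,
      forall i, t i != 0 /\ black X i = (0 < t i),
      forall i j k, t i * t j * t k * chi B i j k =
        kappa * area (Defs.point X i) (Defs.point X j) (Defs.point X k),
      #|black X| = (d + 3)%N &
      black_convex_position X].

Section Between.
Variables (R : realType) (d : nat) (B : 'M[R]_(3, 2 * d + 4)).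
Variables (X : diagram R 2 (2 * d + 4)) (t : 'I_(2 * d + 4) -> R) (kappa : R).
Hypothesis ch : gale_chart B X t kappa.
Local Notation pt i := (Defs.point X i).

Lemma chart_area_neq0 i j k : i != j -> i != k -> j != k ->
  area (pt i) (pt j) (pt k) != 0.
Proof.
case: ch => bal tb tchi cb cX.
exact: (area_neq0 bal (fun i => (tb i).1) tchi).
Qed.

Lemma chart_point_inj : injective (fun i => pt i).
Proof.
move=> i j /= h; apply: contrapT => /eqP ij.
have [k [ki kj]] := exists_other i j.
have : area (pt i) (pt j) (pt k) != 0 by apply: chart_area_neq0; rewrite // eq_sym.
by rewrite h /area !subrr !mul0r subrr eqxx.
Qed.

(** No three distinct points are collinear, so only the degenerate case of three equal points
    remains, which [between] admits. *)
Lemma chart_between i j k :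
  between (pt i) (pt j) (pt k) <-> i = j /\ j = k.
Proof.
split=> [[a /andP[a0 a1] h]|[-> ->]]; last first.
  exists 2^-1; first by apply/andP; split; lra.
  by rewrite -scalerDl subrK scale1r.
have area0 : area (pt i) (pt j) (pt k) = 0 by rewrite h /area !mxE; ring.
have hq : pt j - pt i = a *: (pt k - pt i).
  by apply/rowP => m; rewrite h !mxE; ring.
have hr : pt k - pt j = (1 - a) *: (pt k - pt i).
  by apply/rowP => m; rewrite h !mxE; ring.
have [ij|ij] := eqVneq i j.
  split=> //; move/eqP: hq; rewrite ij subrr eq_sym scaler_eq0 gt_eqF//=.
  by rewrite subr_eq0 => /eqP /chart_point_inj.
have [ik|ik] := eqVneq i k.
  case/eqP: ij; apply: chart_point_inj => /=; apply/esym/eqP.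
  by rewrite -subr_eq0 hq -ik subrr scaler0.
have [jk|jk] := eqVneq j k; last by have := chart_area_neq0 ij ik jk; rewrite area0 eqxx.
move/eqP: hr; rewrite jk subrr eq_sym scaler_eq0 subr_eq0 (gt_eqF a1)/=.
by rewrite subr_eq0 => /eqP /chart_point_inj kj; case/eqP: ik.
Qed.

End Between.

(** * Comparison of two diagrams *)

Section TwoCharts.
Variables (R : realType) (d : nat) (B C : 'M[R]_(3, 2 * d + 4)).
Local Notation N := (2 * d + 4)%N.
Variables (X Y : diagram R 2 (2 * d + 4)) (t u : 'I_(2 * d + 4) -> R).
Variables (kX kY : R).
Hypothesis d2 : (2 <= d)%N.
Hypothesis chX : gale_chart B X t kX.
Hypothesis chY : gale_chart C Y u kY.
Hypothesis missBC : forall M : {set 'I_N}, #|M| = d.+1 ->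
  missing B M -> missing C M.

Lemma charts_chi_sg : exists2 e : R, e != 0 &
  forall i j k, Num.sg (chi C i j k) = e * Num.sg (chi B i j k).
Proof.
have [balX _ _ _ _] := chX; have [balY _ _ _ _] := chY.
by apply: (chi_sg _ balX balY missBC); lia.
Qed.

(** [side] is a product of two values of [chi], so the global sign enters squared. *)
Lemma charts_side i j k x : (side C i j k x < 0) = (side B i j k x < 0).
Proof.
have [e e0 he] := charts_chi_sg.
rewrite -sgr_lt0 -[RHS]sgr_lt0 /side !sgrM !he mulrACA pmulr_rlt0//.
by rewrite -expr2 exprn_even_gt0.
Qed.

Lemma not_three_recolored i j k : i != j -> i != k -> j != k ->
  i \in [set x | black Y x && ~~ black X x]%SET ->
  j \in [set x | black Y x && ~~ black X x]%SET ->
  k \in [set x | black Y x && ~~ black X x]%SET -> False.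
Proof.
move=> ij ik jk; rewrite !inE => /andP[bi wi] /andP[bj wj] /andP[bk wk].
have [balX tX chiX _ _] := chX; have [balY uY chiY cY cvY] := chY.
have [x [s1 s2 s3]] := exists_interior balY (fun i => (uY i).1)
  (fun i => (uY i).2) chiY cY cvY ij ik jk bi bj bk.
rewrite !charts_side in s1 s2 s3.
have [_ _ _ cX cvX] := chX.
exact: (not_interior_white balX (fun i => (tX i).1)
  (fun i => (tX i).2) chiX cX cvX wi wj wk s1 s2 s3).
Qed.

Lemma charts_black : black X =1 black Y.
Proof.
have [balX tX chiX cX cvX] := chX; have [balY uY chiY cY cvY] := chY.
pose W := [set x | black Y x && ~~ black X x]%SET.
pose K := [set x | black Y x && black X x]%SET.
have W2 : (#|W| <= 2)%N.
  rewrite leqNgt; apply/negP => /card_gt2P[i [j [k [[iW jW kW] [ij jk ki]]]]].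
  by apply: (not_three_recolored ij _ jk iW jW kW); rewrite eq_sym.
have KW : (#|K| + #|W| = d + 3)%N.
  rewrite -cY -!sum1_card [X in (X + _)%N]big_mkcond [X in (_ + X)%N]big_mkcond.
  rewrite [RHS]big_mkcond -big_split /=; apply: eq_bigr => x _.
  by rewrite !inE -topredE /=; case: (black Y x); case: (black X x).
(* At least [d + 1] points are black in both diagrams, which is three or more because [d] is at
   least 2. *)
have : (2 < #|K|)%N by lia.
move=> /card_gt2P[i [j [k [[]]]]]; rewrite !inE.
move=> /andP[yi xi] /andP[yj xj] /andP[yk xk] [ij jk ki].
have ik : i != k by rewrite eq_sym.
have YX x : black Y x -> black X x.
  move=> yx; apply: contrapT => /negP wx.
  have xE z : black X z -> x != z by move=> bz; apply: contraNneq wx => ->.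
  have tx : t x < 0 by rewrite lt_neqAle (tX x).1 leNgt -(tX x).2 wx.
  have ux : 0 < u x by rewrite -(uY x).2.
  have nX a b c := @not_two_outside _ _ _ balX _ _ _ (fun i => (tX i).1)
    (fun i => (tX i).2) chiX cX cvX a b c x.
  have nY a b c := @not_two_outside _ _ _ balY _ _ _ (fun i => (uY i).1)
    (fun i => (uY i).2) chiY cY cvY a b c x.
  have s0 a b c : a != b -> a != c -> b != c -> black X b -> black X c ->
      side B a b c x != 0.
    move=> ab ac bc xb xc; rewrite /side mulf_neq0// (chi_neq0 balX)//.
      by rewrite eq_sym xE.
    by rewrite eq_sym xE.
  (* The three signs are nonzero; being black in [Y] allows at most one negative, being white in [X]
     at most one positive. *)
  have := nX i j k xi xj xk; have := nX j k i xj xk xi; have := nX k i j xk xi xj.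
  have := nY i j k yi yj yk; have := nY j k i yj yk yi; have := nY k i j yk yi yj.
  rewrite !(pmulr_rlt0 _ ux) !(nmulr_rlt0 _ tx) !charts_side.
  have ji : j != i by rewrite eq_sym.
  have kj : k != j by rewrite eq_sym.
  have := s0 i j k ij ik jk xj xk; have := s0 j k i jk ji ki xk xi.
  have := s0 k i j ki kj ij xi xj.
  case: (ltrgt0P (side B i j k x)); case: (ltrgt0P (side B j k i x));
    by case: (ltrgt0P (side B k i j x)) => //; auto.
have /subset_cardP : #|black Y| = #|black X| by rewrite cX cY.
move=> h x; apply/esym; apply: h; apply/fintype.subsetP => y; exact: YX.
Qed.

Lemma charts_orientation : exists2 e : R, e = 1 \/ e = -1 &
  forall i j k, orientation (Defs.point Y i) (Defs.point Y j) (Defs.point Y k) =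
    e * orientation (Defs.point X i) (Defs.point X j) (Defs.point X k).
Proof.
have [e e0 he] := charts_chi_sg.
have [balX tX chiX cX cvX] := chX; have [balY uY chiY cY cvY] := chY.
have kX0 := kappa_neq0 balX (fun i => (tX i).1) chiX.
have kY0 := kappa_neq0 balY (fun i => (uY i).1) chiY.
have sgt i : Num.sg (u i) = Num.sg (t i).
  have := charts_black i; rewrite (tX i).2 (uY i).2.
  have := (tX i).1; have := (uY i).1.
  by case: (sgrP (t i)); case: (sgrP (u i)).
pose f := Num.sg kY * e * Num.sg kX.
have E i j k : orientation (Defs.point Y i) (Defs.point Y j) (Defs.point Y k) =
    f * orientation (Defs.point X i) (Defs.point X j) (Defs.point X k).
  have sX := congr1 Num.sg (chiX i j k); have sY := congr1 Num.sg (chiY i j k).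
  rewrite !orientationE; rewrite !sgrM in sX sY.
  have kk (z : R) : z != 0 -> Num.sg z * Num.sg z = 1.
    by move=> z0; rewrite -expr2 sqr_sg z0.
  rewrite -[LHS]mul1r -(kk _ kY0) -mulrA -sY he !sgt /f.
  rewrite -!mulrA -sX; congr (_ * _).
  rewrite !mulrA; ring.
exists f => //.
(* Only [e != 0] is known so far; one triple of distinct points, with orientation 1 or -1 in both
   diagrams, determines [f] up to sign. *)
have i0 : 'I_N by apply: (@Ordinal _ 0); rewrite addn_gt0 orbT.
have [j [j0 _]] := exists_other i0 i0; have [k [k0 kj]] := exists_other i0 j.
have hX : area (Defs.point X i0) (Defs.point X j) (Defs.point X k) != 0.
  by apply: (chart_area_neq0 chX); rewrite eq_sym.
have hY : area (Defs.point Y i0) (Defs.point Y j) (Defs.point Y k) != 0.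
  by apply: (chart_area_neq0 chY); rewrite eq_sym.
have := E i0 j k; rewrite !orientationE.
case: (sgrP (area (Defs.point X i0) _ _)) hX => // _ _;
case: (sgrP (area (Defs.point Y i0) _ _)) hY => // _ _.
- by rewrite mulr1 => <-; left.
- by rewrite mulr1 => <-; right.
- by rewrite mulrN1 => h; right; rewrite h opprK.
- by rewrite mulrN1 => /oppr_inj <-; left.
Qed.
End TwoCharts.

(** * Balancedness and missing sets from neighborliness *)

Section FromPolytope.
Variables (R : realType) (d : nat) (P : set 'rV[R]_(2 * d)).
Local Notation N := (2 * d + 4)%N.
Variable x : 'I_(2 * d + 4) -> 'rV[R]_(2 * d).
Hypotheses (neiP : neighborly P) (xI : injective x) (xP : range x = vertices P).

Lemma extend_set (T : finType) (A S : {set T}) (m : nat) :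
  A \subset S -> (#|A| + m <= #|S|)%N ->
  exists A' : {set T}, [/\ A \subset A', A' \subset S & #|A'| = (#|A| + m)%N].
Proof.
elim: m A => [|m IH] A AS h; first by exists A; rewrite addn0.
have /properP[_ [z zS zA]] : A \proper S by rewrite properEcard AS; lia.
have [||A' [A1 A2 A3]] := IH (z |: A)%SET.
- by rewrite finset.subUset finset.sub1set zS.
- by rewrite cardsU1 zA; lia.
exists A'; split=> //.
  by apply: fintype.subset_trans A1; apply: finset.subsetUr.
by rewrite A3 cardsU1 zA; lia.
Qed.

Lemma neighborly_face_set (A : {set 'I_N}) : #|A| = d -> face_set P x A.
Proof.
move=> cA; case: neiP => _ /(_ (fun i => x (enum_val (cast_ord (esym cA) i)))).
case.
- by move=> i j /xI /enum_val_inj /cast_ord_inj.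
- by move=> i; apply: vertex_point xP _.
move=> F PF FE; exists F => // i; split => [Fi|iA].
  have := face_point_vertex xP PF Fi; rewrite FE => -[j _ /xI <-].
  exact: enum_valP.
apply: (vertices_sub (Q := F)); rewrite FE.
exists (cast_ord cA (enum_rank_in iA i)) => //=.
by rewrite cast_ordK enum_rankK_in.
Qed.

Variable B : 'M[R]_(3, 2 * d + 4).
Hypothesis galeB : vector_gale x B.

Lemma mulmx_dependency (u : 'rV[R]_3) : affine_dependency x (u *m B).
Proof. by case: galeB => _ _ h; apply/h; apply: submxMl. Qed.

Lemma exists_negative (u : 'rV[R]_3) : u != 0 -> exists i, (u *m B) 0 i < 0.
Proof.
move=> u0; apply: contrapT => /forallNP h.
have [_ l1] := mulmx_dependency u; case: galeB => _ rB _.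
have h0 i : true -> 0 <= (u *m B) 0 i by rewrite leNgt => _; apply/negP/h.
move: u0; rewrite -(mulmx_free_eq0 u rB) => /eqP; apply.
by apply/rowP => i; rewrite [RHS]mxE; apply: (psumr_eq0P h0 l1).
Qed.

(** Otherwise the positive support extends to a [d]-set avoiding some negative coordinate; this set
    is a face, contradicting [face_set_dependency]. *)
Lemma neighborly_balanced (u : 'rV[R]_3) : u != 0 -> (d < #|pos_set B u|)%N.
Proof.
move=> u0; have [i ui] := exists_negative u0.
rewrite ltnNge; apply/negP => cle.
have pS : pos_set B u \subset ~: [set i]%SET.
  apply/fintype.subsetP => j; rewrite !inE => uj; apply/eqP => ji.
  by move: uj; rewrite ji ltNge ltW.
have [|A [A1 A2 A3]] := extend_set (m := d - #|pos_set B u|) pS.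
  by have := cardsC1 i; rewrite card_ord => ->; lia.
have cA : #|A| = d by rewrite A3; lia.
have : i \in A.
  apply: (face_set_dependency xP (mulmx_dependency u) (neighborly_face_set cA) _ ui).
  by move=> j uj; apply: (fintype.subsetP A1); rewrite inE.
by move=> /(fintype.subsetP A2); rewrite !inE eqxx.
Qed.

(** A dependency obstructing the face [M] has its positive support inside [M]; balancedness makes
    this support at least as large as [M], hence equal. *)
Lemma missing_not_face_set (M : {set 'I_N}) : #|M| = d.+1 ->
  missing B M <-> ~ face_set P x M.
Proof.
move=> cM; split=> [[u uM] fM|/(not_face_set_dependency neiP.1 xP)].
  have u0 : u != 0.
    apply/eqP => h; move: cM; rewrite -uM h.
    suff -> : pos_set B 0 = finset.set0 by rewrite cards0.
    by apply/setP => j; rewrite !inE mul0mx mxE ltxx.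
  have [i ui] := exists_negative u0.
  have : i \in M.
    apply: (face_set_dependency xP (mulmx_dependency u) fM _ ui).
    by move=> j uj; rewrite -uM inE.
  by rewrite -uM inE ltNge ltW.
move=> [l [ldep lM [j jM lj]]].
have [_ _ /(_ l)[/(_ ldep) /submxP[u lE] _]] := galeB; exists u.
apply/eqP; rewrite eqEcard cM; apply/andP; split; last first.
  apply: neighborly_balanced; apply/eqP => h.
  by move: lj; rewrite lE h mul0mx mxE ltxx.
apply/fintype.subsetP => i; rewrite inE -lE; apply: contraLR => /lM.
by rewrite leNgt.
Qed.

End FromPolytope.

(** [t i] times column [i] is the homogeneous vector of the point [i] in the basis formed by [o] and
    the rows of [U]; [kappa] is the determinant of that basis. *)
Lemma T_diagram_gale_chart (R : realType) (d : nat) (P : set 'rV[R]_(2 * d))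
    (X : diagram R 2 (2 * d + 4)) : T_diagram P X ->
  exists x B t kappa, [/\ injective x, range x = vertices P, gale_chart B X t kappa &
    forall M : {set 'I_(2 * d + 4)}, #|M| = d.+1 ->
      missing B M <-> ~ face_set P x M].
Proof.
move=> [neiP [x [xI xP [B [galeB [o [U [_ oU _ hX]]]]]]] cb convX].
have /choice[t ht] : forall i, exists t : R,
    t *: (col i B)^T = o + Defs.point X i *m U /\ black X i = (0 < t).
  by move=> i; have [t] := hX i; exists t.
exists x, B, t, (det3 (fun a => o 0 a) (fun a => U 0 a) (fun a => U 1 a)).
split=> //; last by move=> M; apply: missing_not_face_set.
have tB i a : t i * B a i =
    o 0 a + (Defs.point X i 0 0 * U 0 a + Defs.point X i 0 1 * U 1 a).
  have [/(congr1 (fun v : 'rV[R]_3 => v 0 a)) h _] := ht i.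
  move: h; rewrite !mxE => ->; rewrite big_ord_recl big_ord1.
  by congr (_ + (_ + _ * U _ _)); [congr (Defs.point X i _ _)|]; apply: val_inj.
split=> //.
- exact: (neighborly_balanced neiP xI xP galeB).
- move=> i; have [h ->] := ht i; split => //; apply/eqP => ti.
  by have := oU (Defs.point X i); rewrite -h ti scale0r eqxx.
- move=> i j k.
  transitivity (det3 (fun a => t i * B a i) (fun a => t j * B a j)
                     (fun a => t k * B a k)).
    by rewrite /chi /det3; ring.
  by rewrite /det3 /area /= !tB; ring.
Qed.

Theorem theorem1p14 (R : realType) (d : nat) (hd : (2 <= d)%N)
    (P Q : set 'rV[R]_(2 * d)) (X Y : diagram R 2 (2 * d + 4)) :
  T_polytope P -> T_polytope Q -> polytope_equiv P Q ->
  T_diagram P X -> T_diagram Q Y ->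
  diagram_equiv X Y.
Proof.
move=> _ _ PQ TX TY.
have [[polyQ _] _ _ _] := TY.
have [x [B [t [kX [xI xP chX mX]]]]] := T_diagram_gale_chart TX.
have [y [C [u [kY [yI yQ chY mY]]]]] := T_diagram_gale_chart TY.
have [s hs] := polytope_equiv_perm xP xI polyQ yQ PQ.
(* Relabelling along [s] reduces to two charts in which equal indices correspond. *)
pose C' := col_perm s C.
pose Y' := Diagram (fun i => Defs.point Y (s i)) (fun i => black Y (s i)).
have mulC' v i : (v *m C') 0 i = (v *m C) 0 (s i).
  by rewrite !mxE; apply: eq_bigr => k _; rewrite mxE.
have posC' v : pos_set C v = [set s i | i in pos_set C' v]%SET.
  apply/setP => i; rewrite -(permKV s i) mem_imset; last exact: perm_inj.
  by rewrite !inE mulC'.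
have chi' i j k : chi C' i j k = chi C (s i) (s j) (s k).
  by rewrite /chi /det3 !mxE.
have chY' : gale_chart C' Y' (u \o s) kY.
  case: chY => balY uY chiY cY convY; split.
  - move=> v v0; have := balY v v0.
    by rewrite posC' card_imset//; apply: perm_inj.
  - by move=> i /=; apply: uY.
  - by move=> i j k; rewrite chi' chiY.
  - rewrite -cY -(card_imset (black Y') (perm_inj (s := s))).
    apply: eq_card => i; rewrite -(permKV s i) mem_imset//; exact: perm_inj.
  - move=> i bi; have := convY (s i) bi; apply: contra_not => -[n [a [w [ha w0 w1 aw]]]].
    exists n, a, w; split=> // m; have [j [bj ji ->]] := ha m.
    by exists (s j); split => //; rewrite (inj_eq perm_inj).
have missBC' (M : {set 'I_(2 * d + 4)}) : #|M| = d.+1 -> missing B M -> missing C' M.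
  move=> cM /(mX _ cM) fM.
  have cM' : #|[set s i | i in M]%SET| = d.+1.
    by rewrite card_imset//; apply: perm_inj.
  have /(mY _ cM')[v vE] : ~ face_set Q y [set s i | i in M]%SET by move/hs.
  exists v; apply: (imset_inj (@perm_inj _ s)); rewrite -posC'; exact: vE.
exists s; split.
- by move=> i; have /(_ i) := charts_black hd chX chY' missBC'.
- move=> i j k.
  by rewrite (chart_between chX) -(chart_between chY' i j k).
- have [e [->|->] he] := charts_orientation hd chX chY' missBC'; [left|right].
  + by move=> i j k; have := he i j k; rewrite mul1r.
  + by move=> i j k; have := he i j k; rewrite mulN1r.
Qed.
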